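(* Let $A$ be a quasi-category and $X$ a simplicial set. Then $A$ has all limits of shape $X$ if and only if there exists an adjunction $c\dashv\lim$ in $\mathrm{qCat}_2$ with $\lim\colon A^X\to A$ right adjoint to the constant diagram functor $c\colon A\to A^X$.
   Context: A quasi-category is a simplicial set with fillers for all inner horns; functors are simplicial maps between quasi-categories. $\mathrm{qCat}_2$ is the strict 2-category of quasi-categories with hom-categories $\hom'(A,B)=h(B^A)$, where $B^A$ is the internal hom and $h\colon\mathrm{sSet}\to\mathrm{Cat}$ is left adjoint to the nerve. The constant diagram functor $c\colon A\to A^X$ is the transpose of the projection $A\times X\to A$. A 2-cell $\lambda\colon f\ell\Rightarrow g$ (with $f\colon B\to A$, $g\colon C\to A$, $\ell\colon C\to B$) displays $\ell$ as an absolute right lifting of $g$ through $f$ if for all $b\colon Y\to B$, $y\colon Y\to C$ and every 2-cell $\chi\colon fb\Rightarrow gy$ there is a unique 2-cell $\zeta\colon b\Rightarrow\ell y$ with $\chi=\lambda y\cdot f\zeta$. A quasi-category $A$ admits limits of a family of diagrams $k\colon K\to A^X$ if $k$ has an absolute right lifting through $c\colon A\to A^X$; it has all limits of shape $X$ if it admits limits of the family $\mathrm{id}\colon A^X\to A^X$. *)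

(* Defs.v *)
From mathcomp Require Import all_boot.
From mathcomp Require Import boolp.

Set Implicit Arguments.
Unset Strict Implicit.
Unset Printing Implicit Defensive.

Local Open Scope quotient_scope.

(* A morphism [m] -> [n] of the simplex category; [n] is 'I_n.+1. *)
Record monotone (m n : nat) := Monotone {
  mono_fun :> 'I_m.+1 -> 'I_n.+1;
  mono_le : forall i j : 'I_m.+1, i <= j -> mono_fun i <= mono_fun j }.

Lemma monotone_eq m n (f g : monotone m n) : f =1 g -> f = g.
Proof.
case: f g => [f hf] [g hg] /= /funext e; case: _ / e hg => hg.
by congr Monotone; apply: Prop_irrelevance.
Qed.

Definition mono_id n : monotone n n :=
  @Monotone n n (fun i => i) (fun i j h => h).

Definition mono_comp m n p (g : monotone n p) (f : monotone m n) :
    monotone m p :=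
  @Monotone m p (fun i => g (f i)) (fun i j h => mono_le g (mono_le f h)).

Record sSet := SSet {
  simplex :> nat -> Type;
  act : forall m n, monotone m n -> simplex n -> simplex m;
  act_id : forall n (x : simplex n), act (mono_id n) x = x;
  act_comp : forall m n p (g : monotone n p) (f : monotone m n)
    (x : simplex p), act (mono_comp g f) x = act f (act g x) }.
Arguments act {_ _ _}.

Record smap (X Y : sSet) := SMap {
  smap_fun :> forall n, X n -> Y n;
  smap_act : forall m n (t : monotone m n) (x : X n),
    smap_fun (act t x) = act t (smap_fun x) }.

Lemma smap_eq (X Y : sSet) (f g : smap X Y) :
  (forall n (x : X n), f n x = g n x) -> f = g.
Proof.
case: f g => [f hf] [g hg] /= e.
have {}e : f = g by apply: functional_extensionality_dep => n; apply: funext.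
case: _ / e hg => hg; congr SMap; exact: Prop_irrelevance.
Qed.

Definition smap_id (X : sSet) : smap X X :=
  @SMap X X (fun _ x => x) (fun _ _ _ _ => erefl).

Lemma smap_comp_act (X Y Z : sSet) (g : smap Y Z) (f : smap X Y) m n
    (t : monotone m n) (x : X n) :
  g m (f m (act t x)) = act t (g n (f n x)).
Proof. by rewrite !smap_act. Qed.

Definition smap_comp (X Y Z : sSet) (g : smap Y Z) (f : smap X Y) : smap X Z :=
  @SMap X Z (fun n x => g n (f n x)) (smap_comp_act g f).

Notation "g \os f" := (smap_comp g f) (at level 50, left associativity).

Lemma smap_compA (X Y Z W : sSet) (h : smap Z W) (g : smap Y Z)
    (f : smap X Y) : h \os (g \os f) = (h \os g) \os f.
Proof. exact: smap_eq. Qed.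

Lemma smap_comp1s (X Y : sSet) (f : smap X Y) : smap_id Y \os f = f.
Proof. exact: smap_eq. Qed.

Lemma smap_comps1 (X Y : sSet) (f : smap X Y) : f \os smap_id X = f.
Proof. exact: smap_eq. Qed.

Definition Delta (n : nat) : sSet.
Proof.
refine (@SSet (fun m => monotone m n) (fun _ _ t x => mono_comp x t) _ _).
- by move=> m x; apply: monotone_eq.
- by move=> m p q g f x; apply: monotone_eq.
Defined.

Definition Delta_map m n (t : monotone m n) : smap (Delta m) (Delta n).
Proof.
refine (@SMap (Delta m) (Delta n) (fun _ x => mono_comp t x) _).
by move=> p q s x; apply: monotone_eq.
Defined.

Definition sprod (X Y : sSet) : sSet.
Proof.
refine (@SSet (fun n => (X n * Y n)%type)
  (fun _ _ t x => (act t x.1, act t x.2)) _ _).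
- by move=> n [x y]; rewrite /= !act_id.
- by move=> m n p g f [x y]; rewrite /= !act_comp.
Defined.

Definition sfst (X Y : sSet) : smap (sprod X Y) X :=
  @SMap (sprod X Y) X (fun _ x => x.1) (fun _ _ _ _ => erefl).

Definition sprod_map (X X' Y Y' : sSet) (f : smap X X') (g : smap Y Y') :
  smap (sprod X Y) (sprod X' Y').
Proof.
refine (@SMap (sprod X Y) (sprod X' Y') (fun n x => (f n x.1, g n x.2)) _).
by move=> m n t x /=; rewrite !smap_act.
Defined.

(* The internal hom B^A, with n-simplices the maps A x Delta^n -> B. *)
Definition sexp (B A : sSet) : sSet.
Proof.
refine (@SSet (fun n => smap (sprod A (Delta n)) B)
  (fun _ _ t x => x \os sprod_map (smap_id A) (Delta_map t)) _ _).
- move=> n x; apply: smap_eq => m [a s] /=.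
  by congr (x m (_, _)); apply: monotone_eq.
- move=> m n p g f x; apply: smap_eq => q [a s] /=.
  by congr (x q (_, _)); apply: monotone_eq.
Defined.

Definition sexp_post (A B C : sSet) (f : smap B C) :
  smap (sexp B A) (sexp C A).
Proof.
refine (@SMap (sexp B A) (sexp C A) (fun _ x => f \os x) _).
by move=> m n t x; apply: smap_eq.
Defined.

Definition sexp_pre (A B C : sSet) (f : smap A B) :
  smap (sexp C B) (sexp C A).
Proof.
refine (@SMap (sexp C B) (sexp C A)
  (fun n x => x \os sprod_map f (smap_id (Delta n))) _).
by move=> m n t x; apply: smap_eq.
Defined.

Definition transpose (Z X A : sSet) (f : smap (sprod Z X) A) :
  smap Z (sexp A X).
Proof.
have nat n (z : Z n) p q (t : monotone p q) (x : sprod X (Delta n) q) :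
    f p (act (act t x).2 z, (act t x).1) = act t (f q (act x.2 z, x.1)).
  by rewrite -smap_act /= -act_comp.
refine (@SMap Z (sexp A X) (fun n z =>
  @SMap (sprod X (Delta n)) A (fun p x => f p (act x.2 z, x.1)) (nat n z)) _).
by move=> m n t z; apply: smap_eq => p x /=; rewrite act_comp.
Defined.

(* c : A -> A^X is the transpose of the projection A x X -> A. *)
Definition const_diagram (A X : sSet) : smap A (sexp A X) :=
  transpose (sfst A X).

(* The horn Lambda^n_k: the simplices of Delta^n that miss a vertex j != k. *)
Definition in_horn n (k : 'I_n.+1) m (x : monotone m n) : bool :=
  [exists j, (j != k) && [forall i, x i != j]].

Lemma in_horn_act n (k : 'I_n.+1) p q (t : monotone p q) (x : Delta n q) :
  in_horn k x -> in_horn k (act t x).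
Proof.
case/existsP=> j /andP[jk /forallP xj]; apply/existsP; exists j.
by rewrite jk /=; apply/forallP=> i; apply: xj.
Qed.

Definition horn n (k : 'I_n.+1) : sSet.
Proof.
refine (@SSet (fun m => {x : Delta n m | in_horn k x})
  (fun _ _ t x => exist _ (act t (sval x)) (in_horn_act t (svalP x))) _ _).
- by move=> m x; apply: val_inj; exact: act_id.
- by move=> m p q g f x; apply: val_inj; exact: act_comp.
Defined.

Definition horn_incl n (k : 'I_n.+1) : smap (horn k) (Delta n) :=
  @SMap (horn k) (Delta n) (fun _ x => sval x) (fun _ _ _ _ => erefl).

Definition is_quasicategory (X : sSet) : Prop :=
  forall n (k : 'I_n.+1), 0 < k -> k < n ->
  forall s : smap (horn k) X,
  exists t : smap (Delta n) X, t \os horn_incl k = s.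

Record category := Category {
  ob :> Type;
  hom : ob -> ob -> Type;
  idc : forall a, hom a a;
  compc : forall a b c, hom b c -> hom a b -> hom a c;
  compc1 : forall a b (f : hom a b), compc f (idc a) = f;
  comp1c : forall a b (f : hom a b), compc (idc b) f = f;
  compcA : forall a b c d (h : hom c d) (g : hom b c) (f : hom a b),
    compc h (compc g f) = compc (compc h g) f }.
Arguments hom {_}.
Arguments idc {_}.
Arguments compc {_ _ _ _}.

Definition hom_cast (C : category) (a a' b b' : C) (ea : a = a') (eb : b = b')
    (f : hom a b) : hom a' b' :=
  match ea in _ = x, eb in _ = y return hom x y with
  | erefl, erefl => f
  end.

Record cfunctor (C D : category) := CFunctor {
  fob :> C -> D;
  fhom : forall a b, hom a b -> hom (fob a) (fob b);
  fhom1 : forall a, fhom (idc a) = idc (fob a);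
  fhomM : forall a b c (g : hom b c) (f : hom a b),
    fhom (compc g f) = compc (fhom g) (fhom f) }.
Arguments fhom {_ _} _ {_ _}.

Lemma cfunctor_eq_cast (C D : category) (F G : cfunctor C D)
    (e : forall a, F a = G a) :
  (forall a b (f : hom a b), hom_cast (e a) (e b) (fhom F f) = fhom G f) ->
  F = G.
Proof.
case: F G e => [F Fh F1 FM] [G Gh G1 GM] /= e.
have eFG : F = G by apply: funext.
case: _ / eFG Gh G1 GM e => Gh G1 GM e ef.
have eh : Fh = Gh.
  do 3! (apply: functional_extensionality_dep => ?).
  rewrite -ef; case: _ / (Prop_irrelevance (erefl _) (e _)) => /=.
  by case: _ / (Prop_irrelevance (erefl _) (e _)).
case: _ / eh G1 GM {ef} => G1 GM.
by congr CFunctor; apply: Prop_irrelevance.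
Qed.

Lemma cfunctor_comp1 (C D E : category) (G : cfunctor D E) (F : cfunctor C D)
  (a : C) : fhom G (fhom F (idc a)) = idc (G (F a)).
Proof. by rewrite !fhom1. Qed.

Lemma cfunctor_compM (C D E : category) (G : cfunctor D E) (F : cfunctor C D)
    (a b c : C) (g : hom b c) (f : hom a b) :
  fhom G (fhom F (compc g f)) = compc (fhom G (fhom F g)) (fhom G (fhom F f)).
Proof. by rewrite !fhomM. Qed.

Definition cfunctor_comp (C D E : category) (G : cfunctor D E)
    (F : cfunctor C D) : cfunctor C E :=
  @CFunctor C E (fun a => G (F a)) (fun a b f => fhom G (fhom F f))
    (cfunctor_comp1 G F) (cfunctor_compM G F).

Definition ordcat (n : nat) : category.
Proof.
refine (@Category 'I_n.+1 (fun i j => is_true (i <= j)) (fun i => leqnn i)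
  (fun i j k jk ij => leq_trans ij jk) _ _ _);
by move=> *; exact: bool_irrelevance.
Defined.

Definition ordfunctor m n (t : monotone m n) : cfunctor (ordcat m) (ordcat n).
Proof.
refine (@CFunctor (ordcat m) (ordcat n) t (fun i j h => mono_le t h) _ _);
by move=> *; exact: bool_irrelevance.
Defined.

Definition nerve (C : category) : sSet.
Proof.
refine (@SSet (fun n => cfunctor (ordcat n) C)
  (fun _ _ t F => cfunctor_comp F (ordfunctor t)) _ _).
- move=> n F; apply: (@cfunctor_eq_cast _ _ (cfunctor_comp F (ordfunctor (mono_id n))) F
    (fun=> erefl)) => i j h /=.
  by congr (fhom F _); apply: bool_irrelevance.
- move=> m n p g f F.
  apply: (@cfunctor_eq_cast _ _ (cfunctor_comp F (ordfunctor (mono_comp g f)))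
    (cfunctor_comp (cfunctor_comp F (ordfunctor g)) (ordfunctor f))
    (fun=> erefl)) => i j h /=.
  by congr (fhom F _); apply: bool_irrelevance.
Defined.

Definition nerve_map (C D : category) (F : cfunctor C D) :
  smap (nerve C) (nerve D).
Proof.
refine (@SMap (nerve C) (nerve D) (fun _ G => cfunctor_comp F G) _).
move=> m n t G.
by apply: (@cfunctor_eq_cast _ _
  (cfunctor_comp F (cfunctor_comp G (ordfunctor t)))
  (cfunctor_comp (cfunctor_comp F G) (ordfunctor t)) (fun=> erefl)).
Defined.

Definition vertex_op n (i : 'I_n.+1) : monotone 0 n :=
  @Monotone 0 n (fun=> i) (fun _ _ _ => leqnn i).

Lemma edge_op_le n (i j : 'I_n.+1) (ij : i <= j) (a b : 'I_2) :
  a <= b -> (if a == ord0 then i else j) <= (if b == ord0 then i else j).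
Proof.
rewrite -!val_eqE /=; case: (nat_of_ord a) (nat_of_ord b) => [|x] [|y] //=.
Qed.

Definition edge_op n (i j : 'I_n.+1) (ij : i <= j) : monotone 1 n :=
  @Monotone 1 n (fun a => if a == ord0 then i else j) (edge_op_le ij).

Definition degen_op : monotone 1 0 :=
  @Monotone 1 0 (fun=> ord0) (fun _ _ _ => isT).

Section HomotopyCategory.
Variable X : sSet.

Definition src (e : X 1) : X 0 := act (vertex_op ord0) e.
Definition tgt (e : X 1) : X 0 := act (vertex_op ord_max) e.
Definition degen (a : X 0) : X 1 := act degen_op a.

Definition face01 (s : X 2) : X 1 :=
  act (@edge_op 2 (@Ordinal 3 0 isT) (@Ordinal 3 1 isT) isT) s.
Definition face12 (s : X 2) : X 1 :=
  act (@edge_op 2 (@Ordinal 3 1 isT) (@Ordinal 3 2 isT) isT) s.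
Definition face02 (s : X 2) : X 1 :=
  act (@edge_op 2 (@Ordinal 3 0 isT) (@Ordinal 3 2 isT) isT) s.

(* hX is presented by generators and relations: the objects are the vertices
   of X, the morphisms are formal composites of edges, modulo the least
   congruence that contains the category axioms, identifies degenerate edges
   with identities, and identifies the 02-face of each 2-simplex with the
   composite of its 01-face and 12-face. *)
Inductive word : X 0 -> X 0 -> Type :=
| word_id a : word a a
| word_edge a b (e : X 1) : src e = a -> tgt e = b -> word a b
| word_comp a b c : word b c -> word a b -> word a c.

Inductive word_rel : forall a b, word a b -> word a b -> Prop :=
| wr_refl a b (u : word a b) : word_rel u u
| wr_sym a b (u v : word a b) : word_rel u v -> word_rel v u
| wr_trans a b (u v w : word a b) :
    word_rel u v -> word_rel v w -> word_rel u w
| wr_comp a b c (u u' : word b c) (v v' : word a b) :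
    word_rel u u' -> word_rel v v' ->
    word_rel (word_comp u v) (word_comp u' v')
| wr_comp1 a b (u : word a b) : word_rel (word_comp u (word_id a)) u
| wr_1comp a b (u : word a b) : word_rel (word_comp (word_id b) u) u
| wr_compA a b c d (w : word c d) (v : word b c) (u : word a b) :
    word_rel (word_comp w (word_comp v u)) (word_comp (word_comp w v) u)
| wr_degen a (hs : src (degen a) = a) (ht : tgt (degen a) = a) :
    word_rel (word_edge hs ht) (word_id a)
| wr_triangle a b c (s : X 2)
    (h0 : src (face01 s) = a) (h1 : tgt (face01 s) = b)
    (h1' : src (face12 s) = b) (h2 : tgt (face12 s) = c)
    (h0' : src (face02 s) = a) (h2' : tgt (face02 s) = c) :
    word_rel (word_edge h0' h2')
             (word_comp (word_edge h1' h2) (word_edge h0 h1)).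

Definition word_relb a b (u v : {classic word a b}) : bool :=
  `[< @word_rel a b u v >].

Lemma word_relb_refl a b : reflexive (@word_relb a b).
Proof. by move=> u; apply/asboolP; apply: wr_refl. Qed.

Lemma word_relb_sym a b : symmetric (@word_relb a b).
Proof. by move=> u v; apply/asboolP/asboolP; apply: wr_sym. Qed.

Lemma word_relb_trans a b : transitive (@word_relb a b).
Proof.
by move=> v u w /asboolP uv /asboolP vw; apply/asboolP; apply: wr_trans vw.
Qed.

Canonical word_equiv a b := EquivRel (@word_relb a b)
  (@word_relb_refl a b) (@word_relb_sym a b) (@word_relb_trans a b).

Definition hhom a b : Type := {eq_quot (word_equiv a b)}.

Definition wclass a b (u : word a b) : hhom a b := \pi u.
Definition wrepr a b (f : hhom a b) : word a b := repr f.

Lemma wreprK a b (f : hhom a b) : wclass (wrepr f) = f.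
Proof. exact: reprK. Qed.

Lemma wclass_eq a b (u v : word a b) : wclass u = wclass v <-> word_rel u v.
Proof.
split=> [/eqmodP/asboolP//|uv]; by apply/eqmodP/asboolP.
Qed.

Lemma wrepr_class a b (u : word a b) : word_rel (wrepr (wclass u)) u.
Proof. by apply/wclass_eq; rewrite wreprK. Qed.

Definition hid a : hhom a a := wclass (word_id a).
Definition hcomp a b c (g : hhom b c) (f : hhom a b) : hhom a c :=
  wclass (word_comp (wrepr g) (wrepr f)).

Lemma hcomp_class a b c (v : word b c) (u : word a b) :
  hcomp (wclass v) (wclass u) = wclass (word_comp v u).
Proof. by apply/wclass_eq; apply: wr_comp; apply: wrepr_class. Qed.

Definition hcat : category.
Proof.
refine (@Category (X 0) hhom hid hcomp _ _ _).
- move=> a b f; rewrite -[f]wreprK hcomp_class; apply/wclass_eq/wr_comp1.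
- move=> a b f; rewrite -[f]wreprK hcomp_class; apply/wclass_eq/wr_1comp.
- move=> a b c d h g f; rewrite -[h]wreprK -[g]wreprK -[f]wreprK !hcomp_class.
  exact/wclass_eq/wr_compA.
Defined.

End HomotopyCategory.

Section HomotopyFunctor.
Variables (X Y : sSet) (f : smap X Y).

Lemma smap_src a (e : X 1) : src e = a -> src (f 1 e) = f 0 a.
Proof. by move=> <-; rewrite /src smap_act. Qed.

Lemma smap_tgt a (e : X 1) : tgt e = a -> tgt (f 1 e) = f 0 a.
Proof. by move=> <-; rewrite /tgt smap_act. Qed.

Fixpoint word_map a b (u : word a b) : word (f 0 a) (f 0 b) :=
  match u in word a b return word (f 0 a) (f 0 b) with
  | word_id a => word_id (f 0 a)
  | word_edge a b e ha hb => word_edge (smap_src ha) (smap_tgt hb)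
  | word_comp a b c v u => word_comp (word_map v) (word_map u)
  end.

Lemma word_edge_rel (Z : sSet) (a b : Z 0) (e e' : Z 1) (ha : src e = a)
    (hb : tgt e = b) (ha' : src e' = a) (hb' : tgt e' = b) :
  e = e' -> word_edge ha hb = word_edge ha' hb'.
Proof.
by move=> ee; case: _ / ee ha' hb' => ha' hb'; congr word_edge;
   apply: Prop_irrelevance.
Qed.

Lemma word_map_rel a b (u v : word a b) :
  word_rel u v -> word_rel (word_map u) (word_map v).
Proof.
elim=> {a b u v} /=.
- by move=> *; apply: wr_refl.
- by move=> *; apply: wr_sym.
- by move=> a b u v w _ uv _ vw; apply: wr_trans vw.
- by move=> *; apply: wr_comp.
- by move=> *; apply: wr_comp1.
- by move=> *; apply: wr_1comp.
- by move=> *; apply: wr_compA.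
- move=> a hs ht.
  have e : f 1 (degen a) = degen (f 0 a) by rewrite /degen smap_act.
  have hs' : src (degen (f 0 a)) = f 0 a by rewrite -e; apply: smap_src.
  have ht' : tgt (degen (f 0 a)) = f 0 a by rewrite -e; apply: smap_tgt.
  rewrite (word_edge_rel _ _ hs' ht' e); exact: wr_degen.
- move=> a b c s h0 h1 h1' h2 h0' h2'.
  have e01 : f 1 (face01 s) = face01 (f 2 s) by rewrite /face01 smap_act.
  have e12 : f 1 (face12 s) = face12 (f 2 s) by rewrite /face12 smap_act.
  have e02 : f 1 (face02 s) = face02 (f 2 s) by rewrite /face02 smap_act.
  have k0 : src (face01 (f 2 s)) = f 0 a by rewrite -e01; apply: smap_src.
  have k1 : tgt (face01 (f 2 s)) = f 0 b by rewrite -e01; apply: smap_tgt.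
  have k1' : src (face12 (f 2 s)) = f 0 b by rewrite -e12; apply: smap_src.
  have k2 : tgt (face12 (f 2 s)) = f 0 c by rewrite -e12; apply: smap_tgt.
  have k0' : src (face02 (f 2 s)) = f 0 a by rewrite -e02; apply: smap_src.
  have k2' : tgt (face02 (f 2 s)) = f 0 c by rewrite -e02; apply: smap_tgt.
  rewrite (word_edge_rel _ _ k0 k1 e01) (word_edge_rel _ _ k1' k2 e12).
  rewrite (word_edge_rel _ _ k0' k2' e02); exact: wr_triangle.
Qed.

Definition hmap_hom (a b : hcat X) (u : hom a b) :
  @hom (hcat Y) (f 0 a) (f 0 b) := wclass (word_map (wrepr u)).

Lemma hmap_class a b (u : word a b) :
  hmap_hom (wclass u) = wclass (word_map u).
Proof. by apply/wclass_eq; apply: word_map_rel; apply: wrepr_class. Qed.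

Definition hmap : cfunctor (hcat X) (hcat Y).
Proof.
refine (@CFunctor (hcat X) (hcat Y) (f 0) hmap_hom _ _).
- by move=> a; rewrite /= hmap_class.
- move=> a b c g u; rewrite -[g]wreprK -[u]wreprK /= hcomp_class !hmap_class.
  by rewrite hcomp_class.
Defined.

End HomotopyFunctor.

Section Arrow.
Variable C : category.

Definition arrow (a b : C) (f : hom a b) : {a : C & {b : C & hom a b}} :=
  existT _ a (existT _ b f).

Lemma arrow_cast a b a' b' (ea : a = a') (eb : b = b') (f : hom a b) :
  arrow (hom_cast ea eb f) = arrow f.
Proof. by case: _ / ea; case: _ / eb. Qed.

Lemma cast_arrow a b a' b' (f : hom a b) (g : hom a' b') :
  arrow f = arrow g -> forall ea eb, hom_cast ea eb f = g.
Proof.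
move=> E ea eb.
have H (t t' : {a : C & {b : C & hom a b}}) : t = t' ->
    forall (ea : projT1 t = projT1 t')
      (eb : projT1 (projT2 t) = projT1 (projT2 t')),
    hom_cast ea eb (projT2 (projT2 t)) = projT2 (projT2 t').
  move=> {}E; case: _ / E => {}ea {}eb.
  by rewrite (Prop_irrelevance ea erefl) (Prop_irrelevance eb erefl).
exact: (H (arrow f) (arrow g) E ea eb).
Qed.

Lemma arrow_inj a b (f g : hom a b) : arrow f = arrow g -> f = g.
Proof. by move=> /cast_arrow/(_ erefl erefl). Qed.

Lemma arrow_src a b a' b' (f : hom a b) (g : hom a' b') :
  arrow f = arrow g -> a = a'.
Proof. exact: (f_equal (fun t => projT1 t)). Qed.

Lemma arrow_tgt a b a' b' (f : hom a b) (g : hom a' b') :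
  arrow f = arrow g -> b = b'.
Proof. exact: (f_equal (fun t => projT1 (projT2 t))). Qed.

Lemma arrow_comp a b c a' b' c' (g : hom b c) (f : hom a b)
    (g' : hom b' c') (f' : hom a' b') :
  arrow g = arrow g' -> arrow f = arrow f' ->
  arrow (compc g f) = arrow (compc g' f').
Proof.
move=> eg ef.
move: (arrow_src ef) (arrow_src eg) (arrow_tgt eg) => ea eb ec.
case: _ / ea f' ef; case: _ / eb g' eg; case: _ / ec => g' /arrow_inj ->.
by move=> f' /arrow_inj ->.
Qed.

Lemma arrow_id a b : a = b -> arrow (idc a) = arrow (idc b).
Proof. by move=> ->. Qed.

End Arrow.

Lemma cfunctor_eq (C D : category) (F G : cfunctor C D) :
  (forall a b (f : hom a b), arrow (fhom F f) = arrow (fhom G f)) -> F = G.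
Proof.
move=> e; apply: (@cfunctor_eq_cast _ _ _ _
  (fun a => arrow_src (e a a (idc a)))) => a b f.
exact: cast_arrow.
Qed.

Lemma arrow_edge (X : sSet) (a b a' b' : X 0) (e e' : X 1) (ha : src e = a)
    (hb : tgt e = b) (ha' : src e' = a') (hb' : tgt e' = b') :
  e = e' -> @arrow (hcat X) _ _ (wclass (word_edge ha hb)) =
            @arrow (hcat X) _ _ (wclass (word_edge ha' hb')).
Proof.
move=> ee; case: _ / ee ha' hb' => ha' hb'.
by case: _ / ha; case: _ / ha'; case: _ / hb; case: _ / hb'.
Qed.

Section Unit.
Variable X : sSet.

Lemma src_edge n (x : X n) (i j : 'I_n.+1) (ij : i <= j) :
  src (act (edge_op ij) x) = act (vertex_op i) x.
Proof. by rewrite /src -act_comp; congr act; apply: monotone_eq. Qed.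

Lemma tgt_edge n (x : X n) (i j : 'I_n.+1) (ij : i <= j) :
  tgt (act (edge_op ij) x) = act (vertex_op j) x.
Proof. by rewrite /tgt -act_comp; congr act; apply: monotone_eq. Qed.

Definition unit_word n (x : X n) (i j : 'I_n.+1) (ij : i <= j) :
    word (act (vertex_op i) x) (act (vertex_op j) x) :=
  word_edge (src_edge x ij) (tgt_edge x ij).

Lemma triangle_op_le n (i j k : 'I_n.+1) (ij : i <= j) (jk : j <= k)
    (a b : 'I_3) : a <= b ->
  nth k [:: i; j] a <= nth k [:: i; j] b.
Proof.
have ik := leq_trans ij jk.
by case: a b => [[|[|[|//]]] ?] [[|[|[|//]]] ?].
Qed.

Definition triangle_op n (i j k : 'I_n.+1) (ij : i <= j) (jk : j <= k) :
    monotone 2 n :=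
  @Monotone 2 n (fun a : 'I_3 => nth k [:: i; j] a) (triangle_op_le ij jk).

Definition unit_simplex n (x : X n) : cfunctor (ordcat n) (hcat X).
Proof.
refine (@CFunctor (ordcat n) (hcat X) (fun i => act (vertex_op i) x)
  (fun i j ij => wclass (unit_word x ij)) _ _).
- move=> i /=; apply/wclass_eq; rewrite /unit_word.
  have e : act (edge_op (leqnn i)) x = degen (act (vertex_op i) x).
    rewrite /degen -act_comp; congr act; apply: monotone_eq => a /=.
    by case: ifP.
  have hs : src (degen (act (vertex_op i) x)) = act (vertex_op i) x.
    by rewrite -e; apply: src_edge.
  have ht : tgt (degen (act (vertex_op i) x)) = act (vertex_op i) x.
    by rewrite -e; apply: tgt_edge.
  rewrite (word_edge_rel _ _ hs ht e); exact: wr_degen.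
- move=> i j k jk ij /=; rewrite hcomp_class; apply/wclass_eq.
  rewrite /unit_word; set s := act (triangle_op ij jk) x.
  have E01 : act (edge_op ij) x = face01 s.
    rewrite /face01 /s -act_comp; congr act; apply: monotone_eq => a /=.
    by case: ifP.
  have E12 : act (edge_op jk) x = face12 s.
    rewrite /face12 /s -act_comp; congr act; apply: monotone_eq => a /=.
    by case: ifP.
  have E02 : act (edge_op (leq_trans ij jk)) x = face02 s.
    rewrite /face02 /s -act_comp; congr act; apply: monotone_eq => a /=.
    by case: ifP.
  have h0 := src_edge x ij; have h1 := tgt_edge x ij.
  have h1' := src_edge x jk; have h2 := tgt_edge x jk.
  have h0' := src_edge x (leq_trans ij jk).
  have h2' := tgt_edge x (leq_trans ij jk).
  rewrite E01 in h0 h1; rewrite E12 in h1' h2; rewrite E02 in h0' h2'.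
  rewrite (word_edge_rel _ _ h0 h1 E01) (word_edge_rel _ _ h1' h2 E12).
  rewrite (word_edge_rel _ _ h0' h2' E02); exact: wr_triangle.
Defined.

Definition h_unit : smap X (nerve (hcat X)).
Proof.
refine (@SMap X (nerve (hcat X)) unit_simplex _).
move=> m n t x; apply: cfunctor_eq => i j ij.
apply: arrow_edge; rewrite -act_comp; congr act; apply: monotone_eq => a /=.
by case: ifP.
Defined.

End Unit.

Lemma h_unit_natural (X Y : sSet) (f : smap X Y) :
  nerve_map (hmap f) \os h_unit X = h_unit Y \os f.
Proof.
apply: smap_eq => n x; apply: cfunctor_eq => i j ij /=.
rewrite hmap_class; apply: arrow_edge; exact: smap_act.
Qed.

Section Universal.
Variables (X : sSet) (C : category) (G : smap X (nerve C)).

Let vob (a : X 0) : C := (G 0 a : cfunctor _ _) ord0.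
Let le01 : (ord0 : 'I_2) <= (ord_max : 'I_2) := isT.
Let earr (e : X 1) := @fhom _ _ (G 1 e : cfunctor _ _) ord0 ord_max le01.

Let earr_src (e : X 1) a : src e = a -> (G 1 e : cfunctor _ _) ord0 = vob a.
Proof. by move=> <-; rewrite /vob /src smap_act. Qed.

Let earr_tgt (e : X 1) a : tgt e = a -> (G 1 e : cfunctor _ _) ord_max = vob a.
Proof. by move=> <-; rewrite /vob /tgt smap_act. Qed.

Let eval := fix eval a b (u : word a b) : hom (vob a) (vob b) :=
  match u in word a b return hom (vob a) (vob b) with
  | word_id a => idc (vob a)
  | word_edge a b e ha hb => hom_cast (earr_src ha) (earr_tgt hb) (earr e)
  | word_comp a b c v u => compc (eval b c v) (eval a b u)
  end.

Let earr_face n (x : X n) (i j : 'I_n.+1) (ij : i <= j) :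
  arrow (earr (act (edge_op ij) x)) =
  arrow (@fhom _ _ (G n x : cfunctor _ _) i j ij).
Proof.
rewrite /earr smap_act /=; congr arrow; congr (fhom _ _).
exact: bool_irrelevance.
Qed.

Let eval_rel a b (u v : word a b) : word_rel u v -> eval u = eval v.
Proof.
elim=> {a b u v} //=.
- by move=> a b u v w _ -> _ ->.
- by move=> a b c u u' v v' _ -> _ ->.
- by move=> *; rewrite compc1.
- by move=> *; rewrite comp1c.
- by move=> *; rewrite compcA.
- move=> a hs ht; apply: arrow_inj; rewrite arrow_cast /earr /degen smap_act /=.
  rewrite /vob -(fhom1 (G 0 a : cfunctor _ _)); congr arrow.
  by congr (fhom _ _); apply: bool_irrelevance.
- move=> a b c s h0 h1 h1' h2 h0' h2'; apply: arrow_inj.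
  have E : @fhom _ _ (G 2 s : cfunctor _ _) (@Ordinal 3 0 isT)
      (@Ordinal 3 2 isT) isT =
    compc (@fhom _ _ (G 2 s : cfunctor _ _) (@Ordinal 3 1 isT)
             (@Ordinal 3 2 isT) isT)
          (@fhom _ _ (G 2 s : cfunctor _ _) (@Ordinal 3 0 isT)
             (@Ordinal 3 1 isT) isT).
    by rewrite -fhomM; congr (fhom _ _); apply: bool_irrelevance.
  rewrite arrow_cast earr_face E.
  by apply: arrow_comp; rewrite arrow_cast; apply: esym; apply: earr_face.
Qed.

Let ext_hom (a b : hcat X) (f : hom a b) : hom (vob a) (vob b) :=
  eval (wrepr f).

Let ext_class a b (u : word a b) : ext_hom (wclass u) = eval u.
Proof. exact/eval_rel/wrepr_class. Qed.

Let ext : cfunctor (hcat X) C.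
Proof.
refine (@CFunctor (hcat X) C vob ext_hom _ _).
- by move=> a; rewrite ext_class.
- move=> a b c g f; rewrite -[g]wreprK -[f]wreprK /= hcomp_class.
  by rewrite !ext_class.
Defined.

(* With h_unit_natural: hcat and hmap form a left adjoint to the nerve,
   with unit h_unit. *)
Theorem h_nerve_adjunction :
  exists! F : cfunctor (hcat X) C, nerve_map F \os h_unit X = G.
Proof.
exists ext; split.
  apply: smap_eq => n x; apply: cfunctor_eq => i j ij /=.
  by rewrite ext_class /= arrow_cast earr_face.
move=> F EF; apply: cfunctor_eq => a b f; rewrite -[f]wreprK /= ext_class.
have Fob c : vob c = F c.
  rewrite /vob -EF /=; congr (F _); rewrite -[RHS]act_id; congr act.
  by apply: monotone_eq => i; exact: esym (ord1 i).
elim: (wrepr f) => {a b f} [a|a b e ha hb|a b c v IHv u IHu].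
- have /= -> := fhom1 F a; exact: arrow_id.
- rewrite /= arrow_cast; case: _ / ha; case: _ / hb.
  rewrite /earr -EF /= /unit_word.
  rewrite (@word_edge_rel _ _ _ _ e _ _ erefl erefl) //.
  rewrite -[RHS]act_id; congr act; apply: monotone_eq => i /=.
  by case: ifP => [/eqP->//|]; case: i => [[|[|//]] hi] // _; apply: val_inj.
- have /= -> : wclass (word_comp v u) = compc (wclass v : @hom (hcat X) _ _) (wclass u).
    by rewrite /= hcomp_class.
  by rewrite (fhomM F); apply: arrow_comp.
Qed.

End Universal.

Definition name (A B : sSet) (f : smap A B) : sexp B A 0 :=
  f \os sfst A (Delta 0).

(* The 2-category of quasi-categories is full on 2-cells, so its 2-cells,
   compositions and whiskerings are given here for all simplicial sets; the
   restriction to quasi-categories is made where objects are quantified over. *)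
Definition cell (A B : sSet) (f g : smap A B) : Type :=
  @hom (hcat (sexp B A)) (name f) (name g).

Definition cell_id (A B : sSet) (f : smap A B) : cell f f :=
  @idc (hcat (sexp B A)) (name f).

Definition vcomp (A B : sSet) (f g h : smap A B) (v : cell g h) (u : cell f g) :
  cell f h := @compc (hcat (sexp B A)) _ _ _ v u.

Notation "v \v u" := (vcomp v u) (at level 40, left associativity).

(* The identity 2-cell between two equal 1-cells; it mediates the strict
   associativity and unit laws, which hold propositionally only. *)
Definition cell_eq (A B : sSet) (f g : smap A B) (e : f = g) : cell f g :=
  match e in _ = x return cell f x with erefl => cell_id f end.

Lemma name_post (A B C : sSet) (f : smap B C) (g : smap A B) :
  sexp_post A f 0 (name g) = name (f \os g).
Proof. exact: smap_eq. Qed.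

Lemma name_pre (A B C : sSet) (f : smap B C) (g : smap A B) :
  sexp_pre C g 0 (name f) = name (f \os g).
Proof. exact: smap_eq. Qed.

Definition lwhisker (A B C : sSet) (f : smap B C) (g g' : smap A B)
    (u : cell g g') : cell (f \os g) (f \os g') :=
  @hom_cast (hcat (sexp C A)) _ _ _ _ (name_post f g) (name_post f g')
    (fhom (hmap (sexp_post A f)) u).

Definition rwhisker (A B C : sSet) (f f' : smap B C) (u : cell f f')
    (g : smap A B) : cell (f \os g) (f' \os g) :=
  @hom_cast (hcat (sexp C A)) _ _ _ _ (name_pre f g) (name_pre f' g)
    (fhom (hmap (sexp_pre C g)) u).

(* lambda : fl => g displays l as an absolute right lifting of g through f;
   the equation reads chi = (lambda y) (f zeta). *)
Definition is_absolute_right_lifting (A B C : sSet) (f : smap B A)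
    (g : smap C A) (l : smap C B) (lambda : cell (f \os l) g) : Prop :=
  forall Y : sSet, is_quasicategory Y ->
  forall (b : smap Y B) (y : smap Y C) (chi : cell (f \os b) (g \os y)),
  exists! zeta : cell b (l \os y),
    chi = rwhisker lambda y \v cell_eq (smap_compA f l y) \v lwhisker f zeta.

Definition admits_limits_of_family (A X K : sSet) (k : smap K (sexp A X)) :
    Prop :=
  exists (l : smap K A) (lambda : cell (const_diagram A X \os l) k),
    is_absolute_right_lifting lambda.

Definition has_limits_of_shape (A X : sSet) : Prop :=
  admits_limits_of_family (smap_id (sexp A X)).

(* f -| u with unit eta and counit epsilon:
   (epsilon f) (f eta) = id_f and (u epsilon) (eta u) = id_u. *)
Record is_adjunction (A B : sSet) (f : smap A B) (u : smap B A)
    (eta : cell (smap_id A) (u \os f)) (epsilon : cell (f \os u) (smap_id B)) :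
    Prop := IsAdjunction {
  triangle_left :
    cell_eq (smap_comp1s f) \v rwhisker epsilon f
      \v cell_eq (smap_compA f u f)
      \v lwhisker f eta \v cell_eq (esym (smap_comps1 f)) = cell_id f;
  triangle_right :
    cell_eq (smap_comps1 u) \v lwhisker u epsilon
      \v cell_eq (esym (smap_compA u f u))
      \v rwhisker eta u \v cell_eq (esym (smap_comp1s u)) = cell_id u }.

Definition is_left_adjoint_to (A B : sSet) (f : smap A B) (u : smap B A) :
    Prop :=
  exists eta epsilon, @is_adjunction A B f u eta epsilon.

(* Main.v *)
From mathcomp Require Import all_boot boolp classical_sets zify.
Require Import Defs.

(* The equivalence is formal 2-category theory: the absolute right lifting of
   id along c is the counit of an adjunction, testing the lifting property at c
   gives the unit and one triangle identity, and its uniqueness clause at lim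
   gives the other.  The last test takes place over A^X, so A^X has to be a
   quasi-category.

   For this, a map on X x Lambda^n_k is extended to X x Delta^n by Zorn's lemma.
   Let (x, s) be a missing m-simplex, minimal for the pair (m, i), where i is
   the last index with s i < k.  The (m+1)-simplex sigma obtained from it by
   repeating the i-th vertex of x and inserting the value k into s after
   position i has (x, s) as its face opposite to i+1; by minimality all its
   other faces are present, so they form an inner horn that can be filled.
   The graphs are kept closed under these fillers, which makes sigma and
   (x, s) non-degenerate, and hence the extension well defined. *)

Set Implicit Arguments.
Unset Strict Implicit.
Unset Printing Implicit Defensive.

(** * Simplicial operators *)

(** Operators come from functions on natural numbers, so that monotonicity and the simplicial
    identities become linear arithmetic for [lia]. *)
Definition nat_homo m n (f : nat -> nat) :=
  forall a b, a <= b -> b <= m -> f a <= f b <= n.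

Lemma nat_homo_lt m n f (fm : nat_homo m n f) (i : 'I_m.+1) : f i < n.+1.
Proof. by have /andP[_ ?] := fm i i (leqnn _) (leq_ord i). Qed.

Lemma nat_homo_le m n f (fm : nat_homo m n f) (i j : 'I_m.+1) :
  i <= j -> Ordinal (nat_homo_lt fm i) <= Ordinal (nat_homo_lt fm j).
Proof. by move=> ij; have /andP[] := fm i j ij (leq_ord j). Qed.

Definition nat_monotone m n f (fm : nat_homo m n f) : monotone m n :=
  Monotone (nat_homo_le fm).

Lemma face_homo m h : nat_homo m m.+1 (fun a => a + (h <= a)).
Proof. by move=> a b; lia. Qed.

Lemma collapse_homo m i : nat_homo m.+1 m (fun a => minn m (a - (i < a))).
Proof. by move=> a b; lia. Qed.

Lemma merge_homo m i : nat_homo m m (fun a => a - (a == i.+1)).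
Proof. by move=> a b; lia. Qed.

(** [face] is the coface omitting [h], [collapse] the codegeneracy repeating [i], and [merge m i]
    the codegeneracy at [i] followed by the coface omitting [i.+1]. For [i < m], a simplex is fixed
    by [merge m i] exactly when it is degenerate at [i]; for [i >= m] this operator is the
    identity. *)
Definition face m h := nat_monotone (@face_homo m h).
Definition collapse m i := nat_monotone (@collapse_homo m i).
Definition merge m i := nat_monotone (@merge_homo m i).

Definition insert q m (t : monotone q m) (i : nat) (v : 'I_m.+1)
    (tv : forall a : 'I_q.+1, if a <= i then t a <= v else v <= t a) :
  monotone q.+1 m.
Proof.
refine (@Monotone q.+1 m
  (fun a => if a == i.+1 :> nat then v else t (collapse q i a)) _) => a b ab.
have tab := mono_le t (mono_le (collapse q i) ab).
have ta := tv (collapse q i a); have tb := tv (collapse q i b).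
move: (ltn_ord a) (ltn_ord b) ab tab ta tb => /=.
by do 2![case: eqP => ?]; do 2![case: ifP => ?]; lia.
Defined.

(** Consecutive steps are strict, so values grow at least as fast as arguments; counting up from [0]
    and up to [m] leaves only [e a = a]. *)
Lemma monotone_inj_id m (e : monotone m m) :
  (forall a b : 'I_m.+1, b = a.+1 :> nat -> e a <> e b) -> e = mono_id m.
Proof.
move=> einj.
have elt d : forall a b : 'I_m.+1, b = a + d :> nat -> e a + d <= e b.
  elim: d => [|d IH] a b ab; first by have := @mono_le _ _ e a b; lia.
  have bd : a + d < m.+1 by have := ltn_ord b; lia.
  pose c : 'I_m.+1 := Ordinal bd.
  have bc : b = c.+1 :> nat by rewrite ab addnS.
  have ac : e a + d <= e c by apply: IH.
  have cb : e c <= e b by apply: mono_le; rewrite bc.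
  have : e c != e b :> nat by apply/eqP => /val_inj; apply: einj.
  lia.
apply: monotone_eq => a; apply: val_inj => /=.
have ma := leq_ord a; have := leq_ord (e ord_max).
have := elt a ord0 a erefl; have := elt (m - a) a ord_max.
rewrite /= subnKC // => /(_ erefl); lia.
Qed.

(** An [e] other than the identity identifies some [a] with [a.+1], hence absorbs [merge m a]; then
    [z], being fixed by [e], would be degenerate at [a]. *)
Lemma act_id_merge (Z : sSet) m (z : Z m) (e : monotone m m) :
  (forall i, i < m -> act (merge m i) z <> z) -> act e z = z ->
  e = mono_id m.
Proof.
move=> nd ez; apply: monotone_inj_id => a b ab eab.
apply: (nd a); first by have := leq_ord b; lia.
rewrite -{1}ez -act_comp -[RHS]ez; congr act; apply: monotone_eq => c /=.
have [cb|cb] := eqVneq c b.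
  by rewrite cb -eab; congr (e _); apply: val_inj; rewrite /=; lia.
congr (e _); apply: val_inj; rewrite /=.
by have : c != b :> nat by []; lia.
Qed.

(** A choice of preimages under [t] is automatically monotone because [f] is injective, and the
    preimage over [l0] may be prescribed. *)
Lemma monotone_lift q r m (t : monotone q m) (f : monotone r m)
    (l0 : 'I_r.+1) (i : 'I_q.+1) :
  injective f -> (forall l, exists j, t j = f l) -> t i = f l0 ->
  exists u : monotone r q, mono_comp t u = f /\ u l0 = i.
Proof.
move=> finj tf ti.
pose g (l : 'I_r.+1) := if l == l0 then i else projT1 (cid (tf l)).
have tg l : t (g l) = f l.
  by rewrite /g; case: eqP => [->//|_]; case: cid.
have gm (a b : 'I_r.+1) : a <= b -> g a <= g b.
  move=> ab; rewrite leqNgt; apply/negP => gba.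
  have := mono_le t (ltnW gba); have := mono_le f ab; rewrite !tg => fab fba.
  have eab : a = b.
    by apply: finj; apply/val_inj/eqP; rewrite eqn_leq fab.
  by rewrite eab ltnn in gba.
exists (Monotone gm); split; first exact: monotone_eq.
by rewrite /= /g eqxx.
Qed.

(* Eilenberg-Zilber uniqueness. *)
Lemma act_surj_inj (Z : sSet) q m (z : Z m) (t t' : monotone q m) :
  (forall i, i < m -> act (merge m i) z <> z) ->
  (forall l, exists j, t j = l) -> act t z = act t' z -> t = t'.
Proof.
move=> nd ts tt'; apply: monotone_eq => i.
(* [u] is a section of [t] through [i]. Then [t'] after [u] fixes [z], so it is the identity;
   evaluate it at [t i]. *)
have [u [tu ui]] := @monotone_lift _ _ _ t (mono_id m) (t i) i
  (fun _ _ e => e) ts erefl.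
have : act (mono_comp t' u) z = z.
  by rewrite act_comp -tt' -act_comp tu act_id.
move/(act_id_merge nd)/(congr1 (fun e : monotone m m => e (t i))).
by rewrite /= ui.
Qed.

Lemma face_factor q m (t : monotone q m.+1) (j : 'I_m.+2) :
  (forall i, t i != j) -> exists u, t = mono_comp (face m j) u.
Proof.
move=> tj; exists (mono_comp (collapse m j) t); apply: monotone_eq => i.
apply: val_inj; rewrite /=.
have := leq_ord (t i); have := leq_ord j; have : t i != j :> nat by apply: tj.
lia.
Qed.

Lemma horn_hit n (k : 'I_n.+1) m (s : monotone m n) (j : 'I_n.+1) :
  ~~ in_horn k s -> j != k -> exists a, s a = j.
Proof.
move=> /existsPn/(_ j) + jk; rewrite jk /= => /forallPn[a].
by rewrite negbK => /eqP <-; exists a.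
Qed.

Lemma horn_missP n (k : 'I_n.+1) m (s : monotone m n) :
  in_horn k s -> exists2 j, j != k & forall a, s a != j.
Proof. by case/existsP=> j /andP[jk /forallP sj]; exists j. Qed.

Lemma act_nonsurj (Z : sSet) m (z : Z m) (e : monotone m m) (j : 'I_m.+1) :
  (forall a, e a != j) ->
  exists q (t : monotone m q) (w : Z q), q < m /\ act e z = act t w.
Proof.
case: m z e j => [|m] z e j ej.
  by have := ej ord0; rewrite [e _]ord1 [j]ord1 eqxx.
have [u ->] := face_factor ej.
by exists m, u, (act (face m j) z); rewrite act_comp.
Qed.

(** Outside the horn only [k] can be missed, so [k - 1] is hit; the vertices with value below [k]
    form a non-empty initial segment, and [i] is its end. *)
Lemma horn_threshold n (k : 'I_n.+1) m (s : monotone m n) :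
  0 < k -> ~~ in_horn k s ->
  exists i : 'I_m.+1, forall a, (s a < k) = (a <= i).
Proof.
move=> k0 sk; have k1 : k.-1 < n.+1 by have := ltn_ord k; lia.
have [|a sa] := @horn_hit _ _ _ _ (Ordinal k1) sk.
  by rewrite -val_eqE /=; lia.
have Pa : s a < k by rewrite sa /=; lia.
case: (@arg_maxnP _ a (fun b => s b < k) (fun b => b) Pa) => i si imax.
exists i => b; apply/idP/idP => [/imax //|bi].
by have := mono_le s bi; lia.
Qed.

(** * Exponentials of quasi-categories *)

Section HornExtension.
Variables (A X : sSet) (n : nat) (k : 'I_n.+1).
Hypotheses (k_gt0 : 0 < k) (k_ltn : k < n) (hA : is_quasicategory A).

Local Notation Z := (sprod X (Delta n)).

(* A partial map from X x Delta^n to A, given by its graph. *)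
Definition graph := set {m : nat & (Z m * A m)%type}.

Definition relate (G : graph) m (z : Z m) (a : A m) : Prop :=
  G (existT _ m (z, a)).

Definition dom (G : graph) m (z : Z m) : Prop := exists a, relate G z a.

(* The vertices i and i+1 of w have the coordinates k-1 and k in Delta^n, and
   the edge between them is degenerate in X; w is to be obtained by filling
   an inner horn, whose missing face is the one opposite to the vertex i+1. *)
Definition filler m (i : nat) (w : Z m) : Prop :=
  [/\ i < m, forall a : 'I_m.+1, a = i :> nat -> (w.2 a).+1 = k :> nat,
      forall a : 'I_m.+1, a = i.+1 :> nat -> w.2 a = k :> nat &
      act (merge m i) w.1 = w.1].

Record partial_map (G : graph) : Prop := PartialMap {
  pm_act : forall p q (t : monotone p q) (z : Z q) a,
    relate G z a -> relate G (act t z) (act t a);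
  pm_fun : forall q (z : Z q) a b, relate G z a -> relate G z b -> a = b;
  pm_filler : forall q i (w : Z q),
    filler i w -> dom G (act (merge q i) w) -> dom G w }.

(** * Adjoining one missing simplex to a partial map *)

Section Step.
Variable G : graph.
Hypotheses (hG : partial_map G)
  (hornG : forall m (z : Z m), in_horn k z.2 -> dom G z).

Lemma dom_act p q (t : monotone p q) (z : Z q) : dom G z -> dom G (act t z).
Proof. by case=> a za; exists (act t a); apply: pm_act. Qed.

(** Two successive minimisations, of the dimension and then of the threshold; the threshold exists
    because [hornG] puts every missing simplex outside the horn. *)
Lemma minimal_missing m (z : Z m) : ~ dom G z ->
  exists m (z : Z m) (i : 'I_m.+1),
  [/\ ~ dom G z, forall q (w : Z q), q < m -> dom G w,
      forall a, (z.2 a < k) = (a <= i) &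
      forall (w : Z m) (j : 'I_m.+1), j < i ->
        (forall a, (w.2 a < k) = (a <= j)) -> dom G w].
Proof.
move=> nz; pose P q := `[< exists z : Z q, ~ dom G z >].
have [|m' /asboolP[z' nz'] mmin] := @ex_minnP P.
  by exists m; apply/asboolP; exists z.
pose Q j := `[< exists w : Z m', ~ dom G w /\
  exists2 i : 'I_m'.+1, i = j :> nat & forall a, (w.2 a < k) = (a <= i) >].
have [|j /asboolP[w [nw [i ij wi]]] jmin] := @ex_minnP Q.
  have [|i zi] := @horn_threshold n k m' z'.2 k_gt0.
    by apply/negP => /hornG.
  by exists i; apply/asboolP; exists z'; split=> //; exists i.
exists m', w, i; split=> // [q v qm|v l li vl].
  apply: contrapT => nv; have /mmin : P q by apply/asboolP; exists v.
  lia.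
apply: contrapT => nv.
have /jmin : Q l by apply/asboolP; exists v; split=> //; exists l.
lia.
Qed.

Variables (m : nat) (z : Z m) (i : 'I_m.+1).
Hypotheses (nz : ~ dom G z) (dimG : forall q (w : Z q), q < m -> dom G w)
  (zi : forall a, (z.2 a < k) = (a <= i))
  (thrG : forall (w : Z m) (j : 'I_m.+1), j < i ->
     (forall a, (w.2 a < k) = (a <= j)) -> dom G w).

Lemma insert_ok (a : 'I_m.+1) : if a <= i then z.2 a <= k else k <= z.2 a.
Proof. by rewrite -zi; case: ltnP => // /ltnW. Qed.

Let s : monotone m n := z.2.
Let s' : monotone m.+1 n := insert insert_ok.
Let sigma : Z m.+1 := (act (collapse m i) z.1, s').

Let z_nhorn : ~~ in_horn k s.
Proof. by apply/negP => /hornG. Qed.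

(** Since [k < n], the value [n] is hit by [s], necessarily beyond [i]. *)
Let im : i < m.
Proof.
have [|a sa] := @horn_hit _ _ _ _ ord_max z_nhorn.
  by rewrite -val_eqE /=; lia.
have : ~~ (s a < k) by rewrite sa /=; lia.
by rewrite zi; have := ltn_ord a; lia.
Qed.

Let si (a : 'I_m.+1) : a = i :> nat -> (s a).+1 = k :> nat.
Proof.
move=> ai; have k1 : k.-1 < n.+1 by have := ltn_ord k; lia.
have [|b sb] := @horn_hit _ _ _ _ (Ordinal k1) z_nhorn.
  by rewrite -val_eqE /=; lia.
have bi : b <= i by rewrite -zi -/s sb /=; lia.
have ak : s a < k by rewrite zi ai.
have := @mono_le _ _ s b a; rewrite sb ai => /(_ bi) /=; lia.
Qed.

Let s'_new (a : 'I_m.+2) : a = i.+1 :> nat -> s' a = k.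
Proof. by move=> ai /=; case: eqP. Qed.

Let s'_old (a : 'I_m.+2) : a <> i.+1 :> nat -> s' a = s (collapse m i a).
Proof. by move=> ai /=; case: eqP. Qed.

Let s'_lt (a : 'I_m.+2) : (s' a < k) = (a <= i).
Proof.
have [ai|/eqP ai] := eqVneq (a : nat) i.+1; first by rewrite s'_new // ai; lia.
by rewrite s'_old // zi /=; have := ltn_ord a; lia.
Qed.

Let s'_i (a : 'I_m.+2) : a = i :> nat -> (s' a).+1 = k :> nat.
Proof. by move=> ai; rewrite s'_old; [apply: si => /=; lia|lia]. Qed.

Let face_sigma : act (face m i.+1) sigma = z.
Proof.
rewrite [RHS]surjective_pairing /=; congr (_, _).
  rewrite -act_comp -[RHS]act_id; congr act; apply: monotone_eq => a.
  by apply: val_inj => /=; have := ltn_ord a; lia.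
apply: monotone_eq => a; rewrite [LHS]s'_old /=; last by lia.
by congr (s _); apply: val_inj => /=; have := ltn_ord a; lia.
Qed.

Let dom_nonsurj (e : monotone m m) (w : Z m) (j : 'I_m.+1) :
  (forall a, e a != j) -> dom G (act e w).
Proof.
by move=> /(act_nonsurj w)[q [t [v [qm ->]]]]; apply/dom_act/dimG.
Qed.

Let dom_merge (w : Z m) l : l < m -> dom G (act (merge m l) w).
Proof.
move=> lm; apply: (@dom_nonsurj _ _ (Ordinal (lm : l.+1 < m.+1))) => a.
by rewrite -val_eqE /=; case: eqP; lia.
Qed.

Let z_merge l : l < m -> act (merge m l) z <> z.
Proof. by move=> lm e; apply: nz; rewrite -e; apply: dom_merge. Qed.

(** A degeneracy of [sigma] away from [i] and [i.+1] restricts to one of [z]. At [i] it is excluded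
    by the values [k - 1] and [k] of [s']. At [i.+1] it would make [z] a filler at [i], hence
    present by [pm_filler]. *)
Let sigma_merge l : l < m.+1 -> act (merge m.+1 l) sigma <> sigma.
Proof.
move=> lm e.
have zface : act (mono_comp (merge m.+1 l) (face m i.+1)) sigma = z.
  by rewrite act_comp e face_sigma.
have [li|il] := ltnP l i.
  apply: (@z_merge l); first by lia.
  rewrite -{1}face_sigma -act_comp -[RHS]zface; congr act.
  by apply: monotone_eq => a; apply: val_inj => /=; lia.
have [il1|il1] := ltnP i.+1 l.
  apply: (@z_merge l.-1); first by lia.
  rewrite -{1}face_sigma -act_comp -[RHS]zface; congr act.
  by apply: monotone_eq => a; apply: val_inj => /=; lia.
have s'e a : s' (merge m.+1 l a) = s' a.
  by have /(congr1 (fun w : Z m.+1 => w.2 a)) := e.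
have {}il : l = i \/ l = i.+1 by lia.
case: il => {il1} el; subst l.
  have i1 : i.+1 < m.+2 by lia.
  have := s'e (Ordinal i1); rewrite [RHS]s'_new // => ek.
  by have := @s'_i (merge m.+1 i (Ordinal i1)); rewrite ek /=; lia.
apply: nz; apply: (@pm_filler _ hG _ i); last exact: dom_merge.
split=> //.
  move=> a ai; have a1 : a.+1 < m.+2 by have := ltn_ord a; lia.
  have := s'e (Ordinal a1); rewrite [LHS]s'_new /= ?ai; last by lia.
  move=> ->; case: eqP => [|_]; first by lia.
  by congr (nat_of_ord (s _)); apply: val_inj => /=; have := ltn_ord a; lia.
move/(congr1 fst): zface => /=; rewrite -act_comp => {2}<-.
rewrite -{1}face_sigma /= -!act_comp; congr act; apply: monotone_eq => a.
by apply: val_inj => /=; have := ltn_ord a; lia.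
Qed.

Let pos : 'I_m.+2 := lift ord0 i.

Let pos_neq (j : 'I_m.+2) : j != pos -> j <> i.+1 :> nat.
Proof. by move=> /eqP jp ji; apply/jp/val_inj. Qed.

(** A face outside the horn still has the repeated vertex of [sigma] if [j] is neither [i] nor
    [i.+1]; it is then a filler, at [i.-1] or [i], and closure applies. *)
Let dom_face (j : 'I_m.+2) : j != pos -> dom G (act (face m j) sigma).
Proof.
move/pos_neq => ji; set w := act _ _.
have [/hornG//|whorn] := boolP (in_horn k w.2).
have w2 a : (w.2 a < k) = (a + (j <= a) <= i) by rewrite [LHS]s'_lt.
have w1 l : (forall a, collapse m i (face m j (merge m l a)) =
    collapse m i (face m j a) :> nat) -> act (merge m l) w.1 = w.1.
  move=> e; rewrite /w /= -!act_comp; congr act; apply: monotone_eq => a.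
  exact/val_inj/e.
have wk1 (a : 'I_m.+1) : a + (j <= a) = i -> (w.2 a).+1 = k :> nat.
  by move=> aj; apply: (@s'_i (face m j a)).
have wk (a : 'I_m.+1) : a + (j <= a) = i.+1 -> w.2 a = k :> nat.
  by move=> aj; rewrite -(@s'_new (face m j a)).
have [jlt|jgt|jeq] := ltngtP j i.
- apply: (pm_filler hG (i := i.-1)); last by apply: dom_merge; lia.
  split; [lia|move=> a ai|move=> a ai|].
  + by apply: wk1; lia.
  + by apply: wk; lia.
  + by apply: w1 => a /=; have := ltn_ord a; lia.
- apply: (pm_filler hG (i := i)); last exact: dom_merge.
  split=> //[a ai|a ai|].
  + by apply: wk1; lia.
  + by apply: wk; lia.
  + by apply: w1 => a /=; have := ltn_ord a; have := ltn_ord j; lia.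
(* Omitting vertex [i] lowers the threshold to [i.-1]; it stays non-negative because the face still
   hits [k - 1]. *)
- have k1 : k.-1 < n.+1 by have := ltn_ord k; lia.
  have [|a wa] := @horn_hit _ _ _ _ (Ordinal k1) whorn.
    by rewrite -val_eqE /=; lia.
  have : w.2 a < k by rewrite wa /=; lia.
  rewrite w2 => ai; have i1 : i.-1 < m.+1 by lia.
  by apply: (@thrG w (Ordinal i1)) => [/=|b]; rewrite ?w2 /=; lia.
Qed.

Let dom_horn q (t : monotone q m.+1) :
  in_horn pos t -> dom G (act t sigma).
Proof.
move=> /horn_missP[j /dom_face jp /face_factor[u ->]].
by rewrite act_comp; apply: dom_act.
Qed.

(** Such a [t] hits every vertex but possibly [pos], so [face m i.+1] lifts through it and [z] is a
    restriction of [act t sigma]. *)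
Let ndom_nhorn q (t : monotone q m.+1) :
  ~~ in_horn pos t -> ~ dom G (act t sigma).
Proof.
move=> tn dt; have hit l : exists j, t j = face m i.+1 l.
  apply: (horn_hit tn); rewrite -val_eqE /= /bump /=; lia.
have [j tj] := hit ord0.
have finj : injective (face m i.+1).
  by move=> a b /(congr1 val) /= ab; apply: ord_inj; lia.
have [u [tu _]] := monotone_lift finj hit tj.
by apply: nz; rewrite -face_sigma -tu act_comp; apply: dom_act.
Qed.

(** If one operator hits [pos] it is surjective, and non-degeneracy of [sigma] applies; otherwise
    both factor through the face [z], which is non-degenerate too. *)
Let nhorn_inj q (t t' : monotone q m.+1) :
  ~~ in_horn pos t -> ~~ in_horn pos t' ->
  act t sigma = act t' sigma -> t = t'.
Proof.
move=> tn tn' tt'.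
have [[a ta]|tpos] := pselect (exists a, t a = pos).
  apply: (act_surj_inj sigma_merge _ tt') => l.
  have [->|lp] := eqVneq l pos; [by exists a|exact: horn_hit tn lp].
have [[a ta]|tpos'] := pselect (exists a, t' a = pos).
  apply/esym/(act_surj_inj sigma_merge _ (esym tt')) => l.
  have [->|lp] := eqVneq l pos; [by exists a|exact: horn_hit tn' lp].
have factor (r : monotone q m.+1) : ~ (exists a, r a = pos) ->
    exists u, r = mono_comp (face m pos) u.
  by move=> rp; apply: face_factor => b; apply/eqP => e; apply: rp; exists b.
have [u tu] := factor _ tpos; have [u' tu'] := factor _ tpos'.
have pn l : face m pos l != pos by rewrite -val_eqE /= /bump /=; lia.
rewrite tu tu'; congr mono_comp; apply: (act_surj_inj z_merge).
  move=> l; have [j tj] := horn_hit tn (pn l); exists j.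
  by move: tj; rewrite tu /= => /(congr1 val) /= tj; apply: ord_inj; lia.
by rewrite -face_sigma -!act_comp -[mono_comp _ u]tu -[mono_comp _ u']tu'.
Qed.

(** By [pm_fun] the values on the faces of [sigma] other than [z] assemble into a map on the horn at
    [pos], which is inner because [i < m]. *)
Let fill_horn : exists a : A m.+1, forall q (t : monotone q m.+1),
  in_horn pos t -> relate G (act t sigma) (act t a).
Proof.
pose h q (t : horn pos q) := projT1 (cid (dom_horn (svalP t))).
have hP q (t : horn pos q) : relate G (act (sval t) sigma) (h q t).
  by rewrite /h; case: cid.
have h_act p q (r : monotone p q) (t : horn pos q) :
    h p (act r t) = act r (h q t).
  apply: (pm_fun hG (hP _ _)).
  by have := pm_act hG r (hP q t); rewrite -act_comp.
have [||f fh] := @hA m.+1 pos _ _ (@SMap (horn pos) A h h_act).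
- by [].
- by rewrite /= /bump /=; lia.
exists (f _ (mono_id m.+1)) => q t tn.
have := congr1 (fun g : smap (horn pos) A => g q (exist _ t tn)) fh.
rewrite -smap_act /= => e.
have -> : f q (mono_comp (mono_id m.+1) t) = f q t.
  by congr (f q _); apply: monotone_eq.
rewrite e; exact: (hP q (exist _ t tn)).
Qed.

(** This gives closure of the new simplices under [pm_filler]: [u] is [t] with the value at [l.+1]
    changed to [pos]. *)
Let filler_nhorn q l (w : Z q) (t : monotone q m.+1) :
  filler l w -> ~~ in_horn pos t -> act (merge q l) w = act t sigma ->
  exists u : monotone q m.+1, w = act u sigma.
Proof.
move=> [lq wl wl1 wm] tn wt.
have merge_old (a : 'I_q.+1) : a <> l.+1 :> nat -> merge q l a = a.
  by move=> al; apply: ord_inj => /=; lia.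
(* [merge q l] is idempotent, so [t] and its composite with it restrict [sigma] to the same
   simplex. *)
have tmerge : mono_comp t (merge q l) = t.
  apply: nhorn_inj => //.
    apply/negP => /dom_horn; apply: contra_not (ndom_nhorn tn).
    rewrite act_comp -wt -act_comp; congr (dom G (act _ w)).
    by apply: monotone_eq => a; apply: ord_inj => /=; lia.
  rewrite act_comp -wt -act_comp; congr (act _ w).
  by apply: monotone_eq => a; apply: ord_inj => /=; lia.
have wE (a : 'I_q.+1) : w.2 (merge q l a) = s' (t a).
  by have /(congr1 (fun v : Z q => v.2 a)) := wt.
have wk (a : 'I_q.+1) : (w.2 a < k) = (a <= l).
  have l1 : l.+1 < q.+1 by [].
  have l0 : l < q.+1 by lia.
  have [al|la] := leqP a l.
    have := @mono_le _ _ w.2 a (Ordinal l0) al.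
    by have := wl (Ordinal l0) erefl; lia.
  have := @mono_le _ _ w.2 (Ordinal l1) a la.
  by have := wl1 (Ordinal l1) erefl; lia.
have ti (a : 'I_q.+1) : (t a <= i) = (merge q l a <= l).
  by rewrite -s'_lt -wE wk.
have ui (a b : 'I_q.+1) : a <= b ->
    (if a == l.+1 :> nat then pos else t a) <=
    (if b == l.+1 :> nat then pos else t b).
  move=> ab; have := ti a; have := ti b; have := mono_le t ab.
  by case: eqP => al; case: eqP => bl //=; rewrite /bump /=; lia.
exists (Monotone ui).
(* [i] differs from [pos], so [t] hits it, at a vertex that [merge q l] sends to [l] or before. *)
have tl (a : 'I_q.+1) : a = l :> nat -> t a = i :> nat.
  move=> al; have i2 : i < m.+2 by lia.
  have te (b : 'I_q.+1) : t (merge q l b) = t b.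
    exact: (congr1 (fun r : monotone q m.+1 => r b) tmerge).
  have [|b tb] := horn_hit tn (_ : Ordinal i2 != pos).
    by rewrite -val_eqE /= /bump /=; lia.
  have bl : merge q l b <= l by rewrite -ti tb.
  have ta : t a <= i by rewrite ti merge_old; lia.
  have : t (merge q l b) <= t a by apply: mono_le; rewrite al.
  by rewrite te tb /=; lia.
rewrite [LHS]surjective_pairing /=; congr (_, _).
  rewrite -wm; have /(congr1 fst)/= -> := wt.
  rewrite -!act_comp; congr act; apply: monotone_eq => a; apply: ord_inj => /=.
  case: eqP => al //.
  have -> : t a = i :> nat.
    have /(congr1 val)/= <- := congr1 (fun r : monotone q m.+1 => r a) tmerge.
    by apply: tl => /=; lia.
  by rewrite /= /bump; lia.
apply: monotone_eq => a.
have -> : mono_comp s' (Monotone ui) a =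
  s' (if a == l.+1 :> nat then pos else t a) by [].
case: eqP => al; first by apply: ord_inj; rewrite s'_new // wl1.
by rewrite -[in LHS](merge_old a al) wE.
Qed.

Lemma extension_step :
  exists G', [/\ partial_map G', (G `<=` G')%classic & dom G' z].
Proof.
have [a aP] := fill_horn.
pose G' : graph := fun p => G p \/
  exists t : monotone (projT1 p) m.+1, projT2 p = (act t sigma, act t a).
have relG' q (w : Z q) b : relate G' w b <-> relate G w b \/
  exists t : monotone q m.+1, (w, b) = (act t sigma, act t a) by [].
have newP q (t : monotone q m.+1) : relate G' (act t sigma) (act t a).
  by right; exists t.
(* On the horn the added pairs already lie in [G], so a genuinely new pair comes from an operator
   outside it. *)
have notnew q (w : Z q) b : relate G' w b -> ~ relate G w b ->
    exists2 t : monotone q m.+1, ~~ in_horn pos t &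
      w = act t sigma /\ b = act t a.
  case=> // -[t [-> ->]] nw; exists t => //.
  by apply/negP => /aP.
exists G'; split; last by exists (act (face m i.+1) a); rewrite -face_sigma.
- split.
  + move=> p q t w b [wb|[u [-> ->]]]; first by left; apply: pm_act.
    by have := newP _ (mono_comp u t); rewrite !act_comp.
  (* An old and a new value never share a simplex, by [ndom_nhorn]; two new ones come from the same
     operator, by [nhorn_inj]. *)
  + move=> q w b c wb wc.
    have [wb0|nwb] := pselect (relate G w b); last first.
      have [t tn [wt bt]] := notnew _ _ _ wb nwb.
      have [wc0|nwc] := pselect (relate G w c).
        by case: (ndom_nhorn tn); rewrite -wt; exists c.
      have [u un [wu cu]] := notnew _ _ _ wc nwc.
      by rewrite bt cu (nhorn_inj tn un) // -wt.
    have [wc0|nwc] := pselect (relate G w c); first exact: pm_fun wb0 wc0.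
    have [u un [wu cu]] := notnew _ _ _ wc nwc.
    by case: (ndom_nhorn un); rewrite -wu; exists b.
  + move=> q l w [lq wl wl1 wm] [b wb].
    have [wb0|nwb] := pselect (relate G (act (merge q l) w) b).
      have [|c wc] := pm_filler hG (And4 lq wl wl1 wm); first by exists b.
      by exists c; left.
    have {b wb nwb} [t tn [wt _]] := notnew _ _ _ wb nwb.
    have [u ->] := filler_nhorn (And4 lq wl wl1 wm) tn wt.
    by exists (act u a); apply: newP.
- by move=> p Gp; left.
Qed.

End Step.
(** Zorn's lemma is applied to the graphs whose union with [G0] is a partial map; this covers the
    empty chain and keeps [G0] inside the result. *)
Lemma partial_map_total (G0 : graph) : partial_map G0 ->
  (forall m (z : Z m), in_horn k z.2 -> dom G0 z) ->
  exists G, [/\ partial_map G, (G0 `<=` G)%classic &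
    forall m (z : Z m), dom G z].
Proof.
move=> pG0 hornG0.
pose P (G : graph) := partial_map (G0 `|` G)%classic.
have [F FP Ftot|G [PG Gmax]] := @Zorn_bigcup _ P.
  (* The clauses of [partial_map] have at most two pairs as premises, so each can be checked in one
     member of the chain, joined with [G0]. *)
  have common p q (z : Z p) a (w : Z q) b :
      relate (G0 `|` \bigcup_(G in F) G)%classic z a ->
      relate (G0 `|` \bigcup_(G in F) G)%classic w b ->
      exists G, [/\ partial_map G,
        (G `<=` G0 `|` \bigcup_(G in F) G)%classic,
        relate G z a & relate G w b].
    have FG G : F G ->
        (G0 `|` G `<=` G0 `|` \bigcup_(G in F) G)%classic.
      by move=> ? v [?|?]; [left|right; exists G].
    move=> [z0|[G FG' zG]] [w0|[H FH wH]].
    - by exists G0; split=> // v; left.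
    - by exists (G0 `|` H)%classic; split; [exact: FP|exact: FG|left|right].
    - by exists (G0 `|` G)%classic; split; [exact: FP|exact: FG|right|left].
    - have [GH|HG] := Ftot _ _ FG' FH.
        by exists (G0 `|` H)%classic; split;
          [exact: FP|exact: FG|right; apply: GH|right].
      by exists (G0 `|` G)%classic; split;
        [exact: FP|exact: FG|right|right; apply: HG].
  split.
  - move=> p q t z a za; have [G [pG sG zG _]] := common _ _ _ _ _ _ za za.
    exact/sG/(pm_act pG).
  - move=> q z a b za zb; have [G [pG _]] := common _ _ _ _ _ _ za zb.
    exact: pm_fun.
  - move=> q i w fw [a wa]; have [G [pG sG wG _]] := common _ _ _ _ _ _ wa wa.
    have [|b wb] := pm_filler pG fw; first by exists a.
    by exists b; apply: sG.
exists (G0 `|` G)%classic; split; [exact: PG|by move=> v; left|].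
move=> m z; apply: contrapT => nz.
have hornG m' (w : Z m') : in_horn k w.2 -> dom (G0 `|` G)%classic w.
  by move=> /hornG0[a wa]; exists a; left.
have [m' [w [i [nw dimG wi thrG]]]] := minimal_missing hornG nz.
have [G' [pG' sG' [a wa]]] := extension_step PG hornG nw dimG wi thrG.
apply: (Gmax G').
  split; first by move=> v Gv; apply: sG'; right.
  by move=> /(_ _ wa) Gw; apply: nw; exists a; right.
rewrite /P (_ : G0 `|` G' = G')%classic //.
by apply/seteqP; split=> [v [G0v|//]|v]; [apply: sG'; left|right].
Qed.

End HornExtension.

(** A horn in [sexp A X] transposes to a map [val] on X x Lambda^n_k with graph [G0]; a total
    extension of it transposes back. *)
Lemma sexp_quasicategory (A X : sSet) :
  is_quasicategory A -> is_quasicategory (sexp A X).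
Proof.
move=> hA n k k0 kn s.
pose val m (x : X m) (u : horn k m) : A m := s m u m (x, mono_id m).
have valE q m (t : monotone q m) (u : horn k m) (x : X q) :
    s m u q (x, t) = val q x (act t u).
  by rewrite /val smap_act /=; congr (s m u q (_, _)); apply: monotone_eq => a.
have val_act q m (t : monotone q m) (x : X m) (u : horn k m) :
    act t (val m x u) = val q (act t x) (act t u).
  rewrite -valE /val -smap_act /=.
  by congr (s m u q (_, _)); apply: monotone_eq => a.
pose G0 : graph A X n := fun p => exists hu : in_horn k (projT2 p).1.2,
  (projT2 p).2 = val _ (projT2 p).1.1 (exist _ (projT2 p).1.2 hu).
have G0E m (x : X m) (u : horn k m) :
    relate G0 ((x, sval u) : sprod X (Delta n) m) (val m x u).
  by case: u => u hu; exists hu.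
have [||G [pG sG tG]] := @partial_map_total A X n k k0 kn hA G0.
- split.
  + move=> p q t [x u] a [hu /= ->]; rewrite val_act.
    pose v : horn k q := exist _ u hu.
    exact: (G0E p (act t x) (act t v)).
  + move=> q [x u] a b [hu /= ->] [hu' /= ->].
    by rewrite (bool_irrelevance hu hu').
  + move=> q i [x u] [iq ui ui1 _] [a [hu _]].
    (* [merge q i] changes only vertex [i.+1], whose value is [k]; a vertex other than [k] missed
       after merging is thus missed before. *)
    suff hv : in_horn k u by exists (val q x (exist _ u hv)), hv.
    have [j jk uj] := horn_missP hu; apply/existsP; exists j; rewrite jk.
    apply/forallP => a'; have [a'i|/eqP a'i] := eqVneq (a' : nat) i.+1.
      by rewrite -val_eqE /= ui1 // eq_sym.
    suff <- : merge q i a' = a' by exact: uj.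
    by apply: ord_inj => /=; lia.
- by move=> m [x u] hu; exists (val m x (exist _ u hu)), hu.
pose ext m (z : sprod X (Delta n) m) : A m := projT1 (cid (tG m z)).
have extP m z : relate G z (ext m z) by rewrite /ext; case: cid.
have ext_act p q (t : monotone p q) z : ext p (act t z) = act t (ext q z).
  exact: (pm_fun pG (extP _ _) (pm_act pG t (extP q z))).
pose e := @SMap (sprod X (Delta n)) A ext ext_act.
have e_act p q (t : monotone p q) (u : Delta n q) :
  e \os sprod_map (smap_id X) (Delta_map (act t u)) =
  act t ((e \os sprod_map (smap_id X) (Delta_map u)) : sexp A X q).
  by apply: smap_eq => m [x v] /=; congr (ext m (_, _)); apply: monotone_eq.
exists (@SMap (Delta n) (sexp A X)
  (fun q u => e \os sprod_map (smap_id X) (Delta_map u)) e_act).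
apply: smap_eq => q u; apply: smap_eq => m [x v]; rewrite valE.
apply: (pm_fun pG (extP _ _)); apply: sG.
exact: (G0E m x (act v u)).
Qed.

(** * Calculus of 2-cells *)

Section Morphisms.
Variable C : category.

(** Bundling the endpoints allows 2-cells to be compared without casts when their 1-cells agree only
    propositionally. *)
Definition mor := {a : C & {b : C & hom a b}}.
Definition msrc (x : mor) : C := projT1 x.
Definition mtgt (x : mor) : C := projT1 (projT2 x).
Definition mhom (x : mor) : hom (msrc x) (mtgt x) := projT2 (projT2 x).

(* Composition made total by the junk value x when y and x are not composable:
   the associativity and unit constraints between 1-cells then disappear from
   the composites of 2-cells. *)
Definition mcomp (x y : mor) : mor :=
  match pselect (mtgt y = msrc x) with
  | left e => arrow (compc (mhom x) (hom_cast erefl e (mhom y)))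
  | right _ => x
  end.

Local Infix "**" := mcomp (at level 40, left associativity).

Lemma arrow_compc (a b c : C) (g : hom b c) (f : hom a b) :
  arrow (compc g f) = arrow g ** arrow f.
Proof.
by rewrite /mcomp; case: pselect => // e; rewrite (Prop_irrelevance e erefl).
Qed.

Lemma msrc_comp x y : mtgt y = msrc x -> msrc (x ** y) = msrc y.
Proof. by rewrite /mcomp; case: pselect. Qed.

Lemma mtgt_comp x y : mtgt y = msrc x -> mtgt (x ** y) = mtgt x.
Proof. by rewrite /mcomp; case: pselect. Qed.

Lemma mcompA x y z : mtgt y = msrc x -> mtgt z = msrc y ->
  x ** (y ** z) = (x ** y) ** z.
Proof.
case: x y z => [a [b f]] [a' [b' g]] [a'' [b'' h]]; rewrite /msrc /mtgt /=.
move=> e e'; case: _ / e f => f; case: _ / e' g => g.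
by rewrite -[existT _ a'' _]/(arrow h) -!arrow_compc compcA.
Qed.

Lemma mcomp1 x a : msrc x = a -> x ** arrow (idc a) = x.
Proof.
by case: x => [b [c f]]; rewrite /msrc /= => <-; rewrite -arrow_compc compc1.
Qed.

Lemma mcomp1l x a : mtgt x = a -> arrow (idc a) ** x = x.
Proof.
by case: x => [b [c f]]; rewrite /mtgt /= => <-; rewrite -arrow_compc comp1c.
Qed.

End Morphisms.

Infix "**" := mcomp (at level 40, left associativity).

Definition mmap (C D : category) (F : cfunctor C D) (x : mor C) : mor D :=
  arrow (fhom F (mhom x)).

Lemma mmap_comp (C D : category) (F : cfunctor C D) (x y : mor C) :
  mtgt y = msrc x -> mmap F (x ** y) = mmap F x ** mmap F y.
Proof.
case: x y => [a [b f]] [a' [b' g]]; rewrite /msrc /mtgt /= => e.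
case: _ / e f => f; rewrite -arrow_compc -[LHS]/(arrow (fhom F (compc f g))).
by rewrite fhomM arrow_compc.
Qed.

Lemma mmap_id (C D : category) (F : cfunctor C D) (a : C) :
  mmap F (arrow (idc a)) = arrow (idc (F a)).
Proof. by rewrite -fhom1. Qed.

Lemma mmap_hmap_comp (X Y Z : sSet) (g : smap Y Z) (f : smap X Y)
    (x : mor (hcat X)) :
  mmap (hmap (g \os f)) x = mmap (hmap g) (mmap (hmap f) x).
Proof.
case: x => [a [b u]]; rewrite /mmap /= -[u]wreprK !hmap_class; congr arrow.
congr wclass; elim: (wrepr u) => {u a b} //= [a b e ha hb|a b c v -> u -> //].
exact: word_edge_rel.
Qed.

Lemma mmap_hmap_id (X : sSet) (x : mor (hcat X)) :
  mmap (hmap (smap_id X)) x = x.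
Proof.
case: x => [a [b u]]; rewrite /mmap /= -[u]wreprK hmap_class.
rewrite -[RHS]/(@arrow (hcat X) _ _ _); congr arrow.
congr wclass; elim: (wrepr u) => {u a b} //= [a b e ha hb|a b c v -> u -> //].
exact: word_edge_rel.
Qed.

Lemma arrow_triangle (X : sSet) (s : X 2) (a b c a' b' d d' : X 0)
    (h01 : src (face01 s) = a) (k01 : tgt (face01 s) = b)
    (h12 : src (face12 s) = b') (k12 : tgt (face12 s) = c)
    (h02 : src (face02 s) = d) (k02 : tgt (face02 s) = d') :
  @arrow (hcat X) _ _ (wclass (word_edge h12 k12)) **
    @arrow (hcat X) _ _ (wclass (word_edge h01 k01)) =
  @arrow (hcat X) _ _ (wclass (word_edge h02 k02)).
Proof.
have e : b' = b.
  rewrite -h12 -k01 /src /tgt -!act_comp; congr act; exact: monotone_eq.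
have ea : d = a.
  rewrite -h01 -h02 /src -!act_comp; congr act; exact: monotone_eq.
have ec : d' = c.
  rewrite -k12 -k02 /tgt -!act_comp; congr act; exact: monotone_eq.
case: _ / e k01 => k01; case: _ / ea h01 => h01; case: _ / ec k12 => k12.
rewrite -(arrow_compc (C := hcat X)) /= hcomp_class.
congr arrow; apply/wclass_eq/wr_sym; exact: wr_triangle.
Qed.

Definition terminal_op n : monotone n 0 :=
  @Monotone n 0 (fun=> ord0) (fun _ _ _ => isT).

Lemma terminal_opE n (t t' : monotone n 0) : t = t'.
Proof. by apply: monotone_eq => i; rewrite [LHS]ord1 [RHS]ord1. Qed.

(** * Interchange for maps out of a product *)

Section Bifunctor.
Variables (P Q R : sSet) (M : smap (sprod P Q) R).

Definition section_l (q : Q 0) : smap P R.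
Proof.
refine (@SMap P R (fun n x => M n (x, act (terminal_op n) q)) _).
move=> m n t x; rewrite -smap_act /= -act_comp.
by congr (M m (_, act _ _)); apply: terminal_opE.
Defined.

Definition section_r (p : P 0) : smap Q R.
Proof.
refine (@SMap Q R (fun n x => M n (act (terminal_op n) p, x)) _).
move=> m n t x; rewrite -smap_act /= -act_comp.
by congr (M m (act _ _, _)); apply: terminal_opE.
Defined.

Lemma section_l_vertex p q : section_l q 0 p = M 0 (p, q).
Proof.
rewrite /=; congr (M 0 (_, _)); rewrite -[RHS]act_id; congr act.
exact: terminal_opE.
Qed.

Lemma section_r_vertex p q : section_r p 0 q = M 0 (p, q).
Proof.
rewrite /=; congr (M 0 (_, _)); rewrite -[RHS]act_id; congr act.
exact: terminal_opE.
Qed.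

Local Notation ml q := (mmap (hmap (section_l q))).
Local Notation mr p := (mmap (hmap (section_r p))).

Lemma arrow_word_comp (X : sSet) (a b c : X 0) (v : word b c) (u : word a b) :
  @arrow (hcat X) a c (wclass (word_comp v u)) =
  @arrow (hcat X) b c (wclass v) ** @arrow (hcat X) a b (wclass u).
Proof. by rewrite -(arrow_compc (C := hcat X)) /= hcomp_class. Qed.

Lemma mmap_edge (X Y : sSet) (f : smap X Y) (a b : X 0) (e : X 1)
    (ha : src e = a) (hb : tgt e = b) :
  mmap (hmap f) (@arrow (hcat X) a b (wclass (word_edge ha hb))) =
  @arrow (hcat Y) _ _ (wclass (word_edge (smap_src f ha) (smap_tgt f hb))).
Proof. by rewrite /mmap /= hmap_class. Qed.

(** The square spanned by [x] and [y] is cut into two triangles, and both composites equal their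
    common diagonal [M 1 (x, y)]. *)
Lemma interchange_edge p p' q q' (x : P 1) (y : Q 1)
    (hp : src x = p) (hp' : tgt x = p') (hq : src y = q) (hq' : tgt y = q') :
  ml q' (@arrow (hcat P) _ _ (wclass (word_edge hp hp'))) **
    mr p (@arrow (hcat Q) _ _ (wclass (word_edge hq hq'))) =
  mr p' (@arrow (hcat Q) _ _ (wclass (word_edge hq hq'))) **
    ml q (@arrow (hcat P) _ _ (wclass (word_edge hp hp'))).
Proof.
rewrite !mmap_edge.
have diagonal (s : R 2) (e e' : R 1) (a b c d : R 0) (ha : src e = a)
    (hb : tgt e = b) (hc : src e' = c) (hd : tgt e' = d) :
    face01 s = e -> face12 s = e' -> face02 s = M 1 (x, y) ->
    @arrow (hcat R) _ _ (wclass (word_edge hc hd)) **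
      @arrow (hcat R) _ _ (wclass (word_edge ha hb)) =
    @arrow (hcat R) _ _ (wclass (word_edge (erefl (src (M 1 (x, y)))) erefl)).
  move=> e01 e12 e02; rewrite (arrow_edge ha hb erefl erefl (esym e01)).
  rewrite (arrow_edge hc hd erefl erefl (esym e12)).
  rewrite (arrow_edge erefl erefl erefl erefl (esym e02)).
  exact: arrow_triangle.
have opE (t t' : monotone 1 1) : (forall a, t a = t' a :> nat) -> t = t'.
  by move=> tt'; apply: monotone_eq => a; apply: ord_inj.
have edge_case (a : 'I_2) : a = ord0 \/ a = ord_max.
  by case: a => [[|[|//]] a]; [left|right]; apply: ord_inj.
(* In this triangle [y] moves first and [x] second; swapping the two degeneracies gives the other
   triangle. *)
rewrite (@diagonal (M 2 (act (collapse 1 0) x, act (collapse 1 1) y))).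
- rewrite (@diagonal (M 2 (act (collapse 1 1) x, act (collapse 1 0) y))) //.
  + rewrite /face01 -smap_act /= -hq /src -[x in RHS]act_id -!act_comp.
    by congr (M 1 (_, _)); congr act; apply: opE => a;
       case: (edge_case a) => ->.
  + rewrite /face12 -smap_act /= -hp' /tgt -[y in RHS]act_id -!act_comp.
    by congr (M 1 (_, _)); congr act; apply: opE => a;
       case: (edge_case a) => ->.
  + rewrite /face02 -smap_act /= -!act_comp -[x in RHS]act_id -[y in RHS]act_id.
    by congr (M 1 (_, _)); congr act; apply: opE => a;
       case: (edge_case a) => ->.
- rewrite /face01 -smap_act /= -hp /src -[y in RHS]act_id -!act_comp.
  by congr (M 1 (_, _)); congr act; apply: opE => a;
     case: (edge_case a) => ->.
- rewrite /face12 -smap_act /= -hq' /tgt -[x in RHS]act_id -!act_comp.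
  by congr (M 1 (_, _)); congr act; apply: opE => a;
     case: (edge_case a) => ->.
- rewrite /face02 -smap_act /= -!act_comp -[x in RHS]act_id -[y in RHS]act_id.
  by congr (M 1 (_, _)); congr act; apply: opE => a;
     case: (edge_case a) => ->.
Qed.

Lemma section_vertex p q : section_l q 0 p = section_r p 0 q.
Proof. by rewrite section_l_vertex section_r_vertex. Qed.

(** Edges generate both homotopy categories, so nested inductions on words paste the general square
    from squares of edges. *)
Lemma interchange p p' q q' (u : @hom (hcat P) p p') (v : @hom (hcat Q) q q') :
  ml q' (arrow u) ** mr p (arrow v) = mr p' (arrow v) ** ml q (arrow u).
Proof.
have lr := section_vertex; have rl p0 q0 := esym (section_vertex p0 q0).
rewrite -[u]wreprK -[v]wreprK; move: (wrepr u) (wrepr v) => {}u w {v}.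
elim: u q q' w => {p p'}
    [p|p p' x hp hp'|p1 p2 p3 u2 IH2 u1 IH1] q q' w.
- rewrite -[wclass (word_id p)]/(idc (p : hcat P)) !mmap_id.
  by rewrite mcomp1l ?mcomp1 //; apply: rl.
- elim: w => {q q'} [q|q q' y hq hq'|q1 q2 q3 w2 IH2 w1 IH1].
  + rewrite -[wclass (word_id q)]/(idc (q : hcat Q)) !mmap_id.
    by rewrite mcomp1l ?mcomp1 //; apply: lr.
  + exact: interchange_edge.
  + rewrite arrow_word_comp !mmap_comp // mcompA //; last exact: rl.
    rewrite IH2 -mcompA; [|exact: lr|exact: rl].
    by rewrite IH1 mcompA //; apply: lr.
- rewrite arrow_word_comp !mmap_comp // -mcompA //; last exact: rl.
  rewrite IH1 mcompA; [|exact: rl|exact: lr].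
  by rewrite IH2 mcompA //; apply: lr.
Qed.

End Bifunctor.

Lemma sexp_comp_nat (A B C : sSet) n (F : sexp C B n) (G : sexp B A n) p q
    (t : monotone p q) (x : sprod A (Delta n) q) :
  (F : smap _ _) p ((G : smap _ _) p (act t x), (act t x).2) =
  act t ((F : smap _ _) q ((G : smap _ _) q x, x.2)).
Proof. by rewrite -smap_act /= -smap_act. Qed.

(** Internal composition: both factors use the same Delta^n coordinate. *)
Definition sexp_comp_simplex (A B C : sSet) n
    (z : sprod (sexp C B) (sexp B A) n) : sexp C A n :=
  @SMap (sprod A (Delta n)) C
    (fun m x => (z.1 : smap _ _) m ((z.2 : smap _ _) m x, x.2))
    (sexp_comp_nat z.1 z.2).

Lemma sexp_comp_act (A B C : sSet) m n (t : monotone m n)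
    (z : sprod (sexp C B) (sexp B A) n) :
  sexp_comp_simplex (act t z) = act t (sexp_comp_simplex z).
Proof. exact: smap_eq. Qed.

Definition sexp_comp (A B C : sSet) :
  smap (sprod (sexp C B) (sexp B A)) (sexp C A) := SMap (@sexp_comp_act A B C).

Definition lwhisk (A B C : sSet) (f : smap B C) (x : mor (hcat (sexp B A))) :
  mor (hcat (sexp C A)) := mmap (hmap (sexp_post A f)) x.

Definition rwhisk (A B C : sSet) (g : smap A B) (x : mor (hcat (sexp C B))) :
  mor (hcat (sexp C A)) := mmap (hmap (sexp_pre C g)) x.

Definition cell_mor (A B : sSet) (f g : smap A B) (u : cell f g) :
  mor (hcat (sexp B A)) := arrow u.

Section CellCalculus.
Variables A B C D : sSet.

Lemma cell_mor_inj (f g : smap A B) (u v : cell f g) :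
  cell_mor u = cell_mor v -> u = v.
Proof. exact: arrow_inj. Qed.

Lemma cell_mor_vcomp (f g h : smap A B) (v : cell g h) (u : cell f g) :
  cell_mor (v \v u) = cell_mor v ** cell_mor u.
Proof. exact: (arrow_compc (C := hcat (sexp B A))). Qed.

Lemma cell_mor_eq (f g : smap A B) (e : f = g) :
  cell_mor (cell_eq e) = cell_mor (cell_id f).
Proof. by case: _ / e. Qed.

Lemma cell_mor_eql (f g h : smap A B) (e : g = h) (u : cell f g) :
  cell_mor (cell_eq e \v u) = cell_mor u.
Proof.
case: _ / e; rewrite cell_mor_vcomp; exact: (mcomp1l (C := hcat (sexp B A))).
Qed.

Lemma cell_mor_eqr (f g h : smap A B) (e : f = g) (u : cell g h) :
  cell_mor (u \v cell_eq e) = cell_mor u.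
Proof.
case: _ / e u => u; rewrite cell_mor_vcomp.
exact: (mcomp1 (C := hcat (sexp B A))).
Qed.

Lemma cell_mor_lwhisker (f : smap B C) (g g' : smap A B) (u : cell g g') :
  cell_mor (lwhisker f u) = lwhisk f (cell_mor u).
Proof. exact: arrow_cast. Qed.

Lemma cell_mor_rwhisker (f f' : smap B C) (u : cell f f') (g : smap A B) :
  cell_mor (rwhisker u g) = rwhisk g (cell_mor u).
Proof. exact: arrow_cast. Qed.

Lemma lwhisk_mcomp (f : smap B C) (x y : mor (hcat (sexp B A))) :
  mtgt y = msrc x -> lwhisk f (x ** y) = lwhisk f x ** lwhisk f y.
Proof. exact: mmap_comp. Qed.

Lemma rwhisk_mcomp (g : smap A B) (x y : mor (hcat (sexp C B))) :
  mtgt y = msrc x -> rwhisk g (x ** y) = rwhisk g x ** rwhisk g y.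
Proof. exact: mmap_comp. Qed.

Lemma lwhisk1 (x : mor (hcat (sexp B A))) : lwhisk (smap_id B) x = x.
Proof.
rewrite /lwhisk (_ : sexp_post A (smap_id B) = smap_id (sexp B A)).
  exact: mmap_hmap_id.
by apply: smap_eq => n y; apply: smap_eq.
Qed.

Lemma rwhisk1 (x : mor (hcat (sexp B A))) : rwhisk (smap_id A) x = x.
Proof.
rewrite /rwhisk (_ : sexp_pre B (smap_id A) = smap_id (sexp B A)).
  exact: mmap_hmap_id.
by apply: smap_eq => n y; apply: smap_eq => m [a t].
Qed.

Lemma lwhisk_comp (g : smap C D) (f : smap B C) (x : mor (hcat (sexp B A))) :
  lwhisk (g \os f) x = lwhisk g (lwhisk f x).
Proof.
rewrite /lwhisk -mmap_hmap_comp; congr (mmap (hmap _) x).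
by apply: smap_eq => n y; apply: smap_eq.
Qed.

Lemma rwhisk_comp (f : smap B C) (g : smap A B) (x : mor (hcat (sexp D C))) :
  rwhisk (f \os g) x = rwhisk g (rwhisk f x).
Proof.
rewrite /rwhisk -mmap_hmap_comp; congr (mmap (hmap _) x).
by apply: smap_eq => n y; apply: smap_eq.
Qed.

Lemma lrwhisk (f : smap C D) (g : smap A B) (x : mor (hcat (sexp C B))) :
  lwhisk f (rwhisk g x) = rwhisk g (lwhisk f x).
Proof.
rewrite /lwhisk /rwhisk -!mmap_hmap_comp; congr (mmap (hmap _) x).
by apply: smap_eq => n y; apply: smap_eq.
Qed.

Lemma lwhisk_id (f : smap B C) (g : smap A B) :
  lwhisk f (cell_mor (cell_id g)) = cell_mor (cell_id (f \os g)).
Proof.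
rewrite /lwhisk mmap_id.
exact: (@arrow_id (hcat (sexp C A)) _ _ (name_post f g)).
Qed.

Lemma rwhisk_id (f : smap B C) (g : smap A B) :
  rwhisk g (cell_mor (cell_id f)) = cell_mor (cell_id (f \os g)).
Proof.
rewrite /rwhisk mmap_id.
exact: (@arrow_id (hcat (sexp C A)) _ _ (name_pre f g)).
Qed.

(** Pre- and postcomposition are the sections of [sexp_comp] at the vertices [name h]. *)
Lemma whisk_interchange (f f' : smap B C) (g g' : smap A B) (u : cell f f')
    (v : cell g g') :
  rwhisk g' (cell_mor u) ** lwhisk f (cell_mor v) =
  lwhisk f' (cell_mor v) ** rwhisk g (cell_mor u).
Proof.
have preE (h : smap A B) :
    sexp_pre C h = section_l (sexp_comp A B C) (name h).
  by apply: smap_eq => n y; apply: smap_eq.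
have postE (h : smap B C) :
    sexp_post A h = section_r (sexp_comp A B C) (name h).
  by apply: smap_eq => n y; apply: smap_eq.
rewrite /lwhisk /rwhisk !preE !postE; exact: interchange.
Qed.

End CellCalculus.

Ltac composable :=
  first [exact: smap_eq | rewrite mtgt_comp; composable
        | rewrite msrc_comp; composable].

(** * Absolute right liftings and adjunctions *)

Section Adjunction.
Variables (A B : sSet) (f : smap A B) (u : smap B A).

Lemma triangle_leftE (eta : cell (smap_id A) (u \os f))
    (epsilon : cell (f \os u) (smap_id B)) :
  cell_eq (smap_comp1s f) \v rwhisker epsilon f \v cell_eq (smap_compA f u f)
    \v lwhisker f eta \v cell_eq (esym (smap_comps1 f)) = cell_id f <->
  rwhisk f (cell_mor epsilon) ** lwhisk f (cell_mor eta) =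
  cell_mor (cell_id f).
Proof.
have E : cell_mor (cell_eq (smap_comp1s f) \v rwhisker epsilon f
      \v cell_eq (smap_compA f u f) \v lwhisker f eta
      \v cell_eq (esym (smap_comps1 f))) =
    rwhisk f (cell_mor epsilon) ** lwhisk f (cell_mor eta).
  rewrite cell_mor_eqr cell_mor_vcomp cell_mor_eqr cell_mor_eql.
  by rewrite cell_mor_rwhisker cell_mor_lwhisker.
by rewrite -E; split=> [->//|/cell_mor_inj].
Qed.

Lemma triangle_rightE (eta : cell (smap_id A) (u \os f))
    (epsilon : cell (f \os u) (smap_id B)) :
  cell_eq (smap_comps1 u) \v lwhisker u epsilon
    \v cell_eq (esym (smap_compA u f u)) \v rwhisker eta u
    \v cell_eq (esym (smap_comp1s u)) = cell_id u <->
  lwhisk u (cell_mor epsilon) ** rwhisk u (cell_mor eta) =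
  cell_mor (cell_id u).
Proof.
have E : cell_mor (cell_eq (smap_comps1 u) \v lwhisker u epsilon
      \v cell_eq (esym (smap_compA u f u)) \v rwhisker eta u
      \v cell_eq (esym (smap_comp1s u))) =
    lwhisk u (cell_mor epsilon) ** rwhisk u (cell_mor eta).
  rewrite cell_mor_eqr cell_mor_vcomp cell_mor_eqr cell_mor_eql.
  by rewrite cell_mor_rwhisker cell_mor_lwhisker.
by rewrite -E; split=> [->//|/cell_mor_inj].
Qed.

Lemma lifting_eqE (C Y : sSet) (g : smap C B) (l : smap C A)
    (lambda : cell (f \os l) g) (b : smap Y A) (y : smap Y C)
    (chi : cell (f \os b) (g \os y)) (zeta : cell b (l \os y)) :
  chi = rwhisker lambda y \v cell_eq (smap_compA f l y) \v lwhisker f zeta <->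
  cell_mor chi = rwhisk y (cell_mor lambda) ** lwhisk f (cell_mor zeta).
Proof.
have E : cell_mor (rwhisker lambda y \v cell_eq (smap_compA f l y)
      \v lwhisker f zeta) =
    rwhisk y (cell_mor lambda) ** lwhisk f (cell_mor zeta).
  rewrite cell_mor_vcomp cell_mor_eqr.
  by rewrite cell_mor_rwhisker cell_mor_lwhisker.
by rewrite -E; split=> [->//|/cell_mor_inj].
Qed.

(** The lift of [chi] is its transpose, [u] applied to [chi] after [eta] at [b]. The first triangle
    identity gives existence, the second uniqueness. *)
Lemma adjunction_lifting (eta : cell (smap_id A) (u \os f))
    (epsilon : cell (f \os u) (smap_id B)) :
  is_adjunction eta epsilon -> is_absolute_right_lifting epsilon.
Proof.
case=> /triangle_leftE T1 /triangle_rightE T2 Y _ b y chi.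
pose zeta : cell b (u \os y) :=
  cell_eq (f_equal (smap_comp u) (smap_comp1s y)) \v lwhisker u chi
  \v cell_eq (esym (smap_compA u f b)) \v rwhisker eta b
  \v cell_eq (esym (smap_comp1s b)).
have zetaE : cell_mor zeta =
    lwhisk u (cell_mor chi) ** rwhisk b (cell_mor eta).
  rewrite cell_mor_eqr cell_mor_vcomp cell_mor_eqr cell_mor_eql.
  by rewrite cell_mor_rwhisker cell_mor_lwhisker.
exists zeta; split=> [|zeta' /lifting_eqE chiE].
  apply/lifting_eqE; rewrite zetaE lwhisk_mcomp; last by composable.
  (* Naturality of [epsilon] along [chi] brings [epsilon] next to [eta]. *)
  have := whisk_interchange epsilon chi.
  rewrite lwhisk1 rwhisk_comp rwhisk1 lwhisk_comp rwhisk_comp => I.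
  rewrite mcompA; [|composable|composable].
  rewrite I -mcompA; [|composable|composable].
  rewrite lrwhisk -rwhisk_mcomp; last by composable.
  by rewrite T1 rwhisk_id mcomp1.
apply: cell_mor_inj; rewrite zetaE chiE lwhisk_mcomp; last by composable.
have := whisk_interchange eta zeta'.
rewrite lwhisk1 rwhisk_comp lwhisk_comp => I.
rewrite -mcompA; [|composable|composable].
rewrite -I mcompA; [|composable|composable].
rewrite lrwhisk -rwhisk_mcomp; last by composable.
by rewrite T2 rwhisk_id mcomp1l.
Qed.

(* The unit is the lift of the identity of f along f; both the identity of u
   and the composite in the second triangle lift the counit. *)
Lemma lifting_adjunction (epsilon : cell (f \os u) (smap_id B)) :
  is_quasicategory A -> is_quasicategory B ->
  is_absolute_right_lifting epsilon -> exists eta, is_adjunction eta epsilon.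
Proof.
move=> hA hB lift.
have ef : f \os smap_id A = smap_id B \os f by rewrite smap_comps1 smap_comp1s.
have [eta [/lifting_eqE etaE _]] := lift A hA (smap_id A) f (cell_eq ef).
have T1 : rwhisk f (cell_mor epsilon) ** lwhisk f (cell_mor eta) =
    cell_mor (cell_id f).
  by rewrite -etaE cell_mor_eq smap_comps1.
exists eta; split; [exact/triangle_leftE|apply/triangle_rightE].
have eu : u = u \os smap_id B by rewrite smap_comps1.
(* The second triangle composite without its last unit constraint, so that its target has the form
   required of a lift. *)
pose tri : cell u (u \os smap_id B) := lwhisker u epsilon
  \v cell_eq (esym (smap_compA u f u)) \v rwhisker eta u
  \v cell_eq (esym (smap_comp1s u)).
have triE : cell_mor tri =
    lwhisk u (cell_mor epsilon) ** rwhisk u (cell_mor eta).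
  rewrite cell_mor_eqr cell_mor_vcomp cell_mor_eqr.
  by rewrite cell_mor_rwhisker cell_mor_lwhisker.
pose chi : cell (f \os u) (smap_id B \os smap_id B) :=
  cell_eq (esym (smap_comp1s (smap_id B))) \v epsilon.
have [zeta [_ zetaU]] := lift B hB u (smap_id B) chi.
rewrite -triE -(zetaU tri) ?(zetaU (cell_eq eu)) ?cell_mor_eq //.
  apply/lifting_eqE; rewrite cell_mor_eql rwhisk1 cell_mor_eq lwhisk_id.
  by rewrite mcomp1.
apply/lifting_eqE; rewrite cell_mor_eql rwhisk1 triE.
rewrite lwhisk_mcomp; last by composable.
(* Interchanging [epsilon] with itself exposes the first triangle, whiskered by [u]. *)
have := whisk_interchange epsilon epsilon.
rewrite rwhisk1 lwhisk1 lwhisk_comp rwhisk_comp => I.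
rewrite mcompA; [|composable|composable].
rewrite I -mcompA; [|composable|composable].
rewrite lrwhisk -rwhisk_mcomp; last by composable.
by rewrite T1 rwhisk_id mcomp1.
Qed.

End Adjunction.

Theorem proposition5p2p12 (A X : sSet) (hA : is_quasicategory A) :
  has_limits_of_shape A X <->
  exists lim : smap (sexp A X) A, is_left_adjoint_to (const_diagram A X) lim.
Proof.
have hAX := sexp_quasicategory (X := X) hA.
split=> [[lim [epsilon lift]]|[lim [eta [epsilon adj]]]].
  have [eta adj] := lifting_adjunction hA hAX lift.
  by exists lim, eta, epsilon.
by exists lim, epsilon; apply: adjunction_lifting adj.
Qed.
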